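(* Consider the integrated satellite-terrestrial uplink system described in the context, in which the satellite gateway and the APs use maximum-ratio combining (MRC), i.e. $\mathbf{u}_k=\hat{\mathbf{g}}_k$ and $u_{mk}=\hat g_{mk}$ for all $m,k$. For each active user $k\in\mathcal{Q}$ define $z_{kk'}=\mathbf{u}_k^H\mathbf{g}_{k'}+\sum_{m=1}^M u_{mk}^\ast g_{mk'}$ and the effective SINR $$\mathrm{SINR}_k=\frac{\rho_k|\mathbb{E}\{z_{kk}\}|^2}{\sum_{k'\in\mathcal{Q}}\rho_{k'}\mathbb{E}\{|z_{kk'}|^2\}-\rho_k|\mathbb{E}\{z_{kk}\}|^2+\mathbb{E}\{|\mathbf{u}_k^H\mathbf{w}|^2\}+\sum_{m=1}^M\mathbb{E}\{|u_{mk}^\ast w_m|^2\}},$$ with uplink ergodic throughput $R_k=B(1-\tau_p/\tau_c)\log_2(1+\mathrm{SINR}_k)$. Then $R_k=B(1-\tau_p/\tau_c)\log_2(1+\mathrm{SINR}_k)$ with $\mathrm{SINR}_k$ given in closed form by $$\mathrm{SINR}_k=\frac{\rho_k\left(\|\bar{\mathbf{g}}_k\|^2+p\tau_p\,\mathrm{tr}(\mathbf{R}_k\boldsymbol{\Phi}_k\mathbf{R}_k)+\sum_{m=1}^M\gamma_{mk}\right)^2}{\mathsf{MI}_k+\mathsf{NO}_k},$$ where $$\mathsf{MI}_k=\sum_{k'\in\mathcal{P}_k\setminus\{k\}}\rho_{k'}\Big|\bar{\mathbf{g}}_k^H\bar{\mathbf{g}}_{k'}+p\tau_p\,\mathrm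{tr}(\mathbf{R}_{k'}\boldsymbol{\Phi}_k\mathbf{R}_k)+\sum_{m=1}^M\frac{c_{mk'}}{c_{mk}}\gamma_{mk}\Big|^2+\sum_{k'\in\mathcal{K}\setminus\mathcal{P}_k}\rho_{k'}|\bar{\mathbf{g}}_k^H\bar{\mathbf{g}}_{k'}|^2+p\tau_p\sum_{k'\in\mathcal{Q}}\rho_{k'}\bar{\mathbf{g}}_{k'}^H\mathbf{R}_k\boldsymbol{\Phi}_k\mathbf{R}_k\bar{\mathbf{g}}_{k'}+\sum_{k'\in\mathcal{Q}}\rho_{k'}\bar{\mathbf{g}}_k^H\mathbf{R}_{k'}\bar{\mathbf{g}}_k+p\tau_p\sum_{k'\in\mathcal{Q}}\rho_{k'}\mathrm{tr}(\mathbf{R}_{k'}\mathbf{R}_k\boldsymbol{\Phi}_k\mathbf{R}_k)+\sum_{k'\in\mathcal{Q}}\sum_{m=1}^M\rho_{k'}\gamma_{mk}\beta_{mk'},$$ $$\mathsf{NO}_k=\sigma_s^2\|\bar{\mathbf{g}}_k\|^2+p\tau_p\sigma_s^2\,\mathrm{tr}(\mathbf{R}_k\boldsymbol{\Phi}_k\mathbf{R}_k)+\sigma_a^2\sum_{m=1}^M\gamma_{mk}.$$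
   Context: System: $M$ single-antenna access points (APs) indexed by $m\in\{1,\dots,M\}$, $K$ single-antenna users indexed by $k\in\mathcal{K}=\{1,\dots,K\}$, and one satellite with $N$ antennas. The AP–user channels $g_{mk}\sim\mathcal{CN}(0,\beta_{mk})$ ($\beta_{mk}>0$) and satellite–user channels $\mathbf{g}_k\sim\mathcal{CN}(\bar{\mathbf{g}}_k,\mathbf{R}_k)$ ($\bar{\mathbf{g}}_k\in\mathbb{C}^N$, $\mathbf{R}_k\in\mathbb{C}^{N\times N}$ Hermitian positive semidefinite) are all mutually independent. Each coherence interval has $\tau_c$ symbols, $\tau_p$ of which are used for pilots; $B$ is the bandwidth. Pilots: $\tau_p$ orthonormal pilot sequences are reused; $\mathcal{P}_k\subseteq\mathcal{K}$ denotes the set of users assigned the same pilot as user $k$ (so $k\in\mathcal{P}_k$, and $k'\in\mathcal{P}_k\iff\mathcal{P}_{k'}=\mathcal{P}_k$). With pilot power $p$, after projection onto user $k$'s pilot, AP $m$ observes $y_{pmk}=\sqrt{p\tau_p}\sum_{k'\in\mathcal{P}_k}g_{mk'}+n_{mk}$ with $n_{mk}\sim\mathcal{CN}(0,\sigma_a^2)$, and the satellite gateway observes $\mathbf{y}_{pk}=\sqrt{p\tau_p}\sum_{k'\in\mathcal{P}_k}\mathbf{g}_{k'}+\tilde{\mathbf{w}}_{pk}$ with $\tilde{\mathbf{w}}_{pk}\sim\mathcal{CN}(\mathbf{0},\sigma_s^2\mathbf{I}_N)$, noises independent of the channels (and of each other across distinct pilots). Channel estimates are MMSE: $\hat g_{mk}=\mathbb{E}\{g_{mk}|y_{pmk}\}=c_{mk}y_{pmk}$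 with $c_{mk}=\frac{\sqrt{p\tau_p}\beta_{mk}}{\sum_{k'\in\mathcal{P}_k}p\tau_p\beta_{mk'}+\sigma_a^2}$, so $\hat g_{mk}\sim\mathcal{CN}(0,\gamma_{mk})$ with $\gamma_{mk}=\frac{p\tau_p\beta_{mk}^2}{\sum_{k'\in\mathcal{P}_k}p\tau_p\beta_{mk'}+\sigma_a^2}$; and $\hat{\mathbf{g}}_k=\mathbb{E}\{\mathbf{g}_k|\mathbf{y}_{pk}\}=\bar{\mathbf{g}}_k+\sqrt{p\tau_p}\mathbf{R}_k\boldsymbol{\Phi}_k\big(\mathbf{y}_{pk}-\sqrt{p\tau_p}\sum_{k'\in\mathcal{P}_k}\bar{\mathbf{g}}_{k'}\big)$ with $\boldsymbol{\Phi}_k=\big(\sum_{k'\in\mathcal{P}_k}p\tau_p\mathbf{R}_{k'}+\sigma_s^2\mathbf{I}_N\big)^{-1}$, so $\hat{\mathbf{g}}_k\sim\mathcal{CN}(\bar{\mathbf{g}}_k,p\tau_p\mathbf{R}_k\boldsymbol{\Phi}_k\mathbf{R}_k)$. Data phase: a subset $\mathcal{Q}\subseteq\mathcal{K}$ of active users transmits independent zero-mean unit-variance symbols $s_k$ with powers $\rho_k\ge 0$ (inactive users $k\notin\mathcal{Q}$ transmit with zero power, $\rho_k=0$). The satellite receives $\mathbf{y}=\sum_{k\in\mathcal{Q}}\sqrt{\rho_k}\mathbf{g}_ks_k+\mathbf{w}$ and AP $m$ receives $y_m=\sum_{k\in\mathcal{Q}}\sqrt{\rho_k}g_{mk}s_k+w_m$,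 with $\mathbf{w}\sim\mathcal{CN}(\mathbf{0},\sigma_s^2\mathbf{I}_N)$, $w_m\sim\mathcal{CN}(0,\sigma_a^2)$ independent of everything else. The CPU forms $\hat s_k=\mathbf{u}_k^H\mathbf{y}+\sum_{m=1}^M u_{mk}^\ast y_m$. *)

(* Defs.v *)
From HB Require Import structures.
From mathcomp Require Import all_boot all_order all_algebra.
From mathcomp Require Import all_classical all_reals all_analysis.
From mathcomp Require Import complex.
Set Implicit Arguments. Unset Strict Implicit. Unset Printing Implicit Defensive.
Import Order.TTheory GRing.Theory Num.Theory.
Local Open Scope ring_scope.
Local Open Scope complex_scope.

Section LinAlg.
Variable R : rcfType.
Local Notation C := (R[i]).

Definition ctr (m n : nat) (A : 'M[C]_(m, n)) : 'M[C]_(n, m) :=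
  (map_mx (@conjc R) A)^T.

Definition cdot (n : nat) (x y : 'cV[C]_n) : C := (ctr x *m y) 0 0.
Definition cqf (n : nat) (x : 'cV[C]_n) (A : 'M[C]_n) (y : 'cV[C]_n) : C :=
  (ctr x *m A *m y) 0 0.

Definition hermitian (n : nat) (A : 'M[C]_n) : Prop := ctr A = A.
(* Hermitian positive semidefinite (0 <= z in C means z real and >= 0) *)
Definition psd (n : nat) (A : 'M[C]_n) : Prop :=
  hermitian A /\ forall v : 'cV[C]_n, 0 <= cqf v A v.

Definition sqmod (z : C) : R := complex.Re z ^+ 2 + complex.Im z ^+ 2.
End LinAlg.

Section Prob.
Variable R : realType.
Local Notation C := (R[i]).
Variables (d : measure_display) (Om : measurableType d) (P : probability Om R).

(* real expectation (all quantities used below are integrable) *)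
Definition Er (X : Om -> R) : R := fine ('E_P[X])%E.
Definition Ec (X : Om -> C) : C :=
  Er (fun w => complex.Re (X w)) +i* Er (fun w => complex.Im (X w)).

Definition cmeas (n : nat) (X : Om -> 'cV[C]_n) : Prop :=
  forall j : 'I_n, measurable_fun setT (fun w => complex.Re (X w j 0)) /\
                   measurable_fun setT (fun w => complex.Im (X w j 0)).

(* X ~ CN(mu, S): circularly-symmetric complex Gaussian vector, defined by its
   characteristic function E[exp(i Re(t^H (X - mu)))] = exp(- t^H S t / 4). *)
Definition isCN (n : nat) (X : Om -> 'cV[C]_n) (mu : 'cV[C]_n) (S : 'M[C]_n)
  : Prop :=
  cmeas X /\
  forall t : 'cV[C]_n,
    ('E_P[fun w => cos (complex.Re (cdot t (X w - mu)))] =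
       (expR (- complex.Re (cqf t S t) / 4))%:E)%E /\
    ('E_P[fun w => sin (complex.Re (cdot t (X w - mu)))] = 0)%E.

Definition isCN1 (X : Om -> C) (mu s : C) : Prop :=
  @isCN 1 (fun w => (X w)%:M) mu%:M s%:M.

Record crv := CRV { crv_dim : nat; crv_fun : Om -> 'cV[C]_crv_dim }.
Definition crv1 (X : Om -> C) : crv := @CRV 1 (fun w => (X w)%:M).

Definition below (X : crv) (a : nat -> R * R) : set Om :=
  [set w | forall j : 'I_(crv_dim X),
     complex.Re (crv_fun X w j 0) <= (a j).1 /\ complex.Im (crv_fun X w j 0) <= (a j).2].

Definition mutually_independent (I : finType) (F : I -> crv) : Prop :=
  forall a : I -> nat -> R * R,
    P (\bigcap_i below (F i) (a i))%classic =
    (\prod_(i : I) P (below (F i) (a i)))%E.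
End Prob.

Section Model.
Variable R : realType.
Local Notation C := (R[i]).
(* M APs, K users, N satellite antennas, Tp = tau_p pilots *)
Variables (M K N Tp : nat).
Variables (p sa2 ss2 : R).               (* pilot power, sigma_a^2, sigma_s^2 *)
Variable beta : 'I_M -> 'I_K -> R.        (* large-scale fading beta_mk *)
Variable gbar : 'I_K -> 'cV[C]_N.         (* LoS mean of satellite channel *)
Variable Rk : 'I_K -> 'M[C]_N.            (* covariance R_k *)
Variable pil : 'I_K -> 'I_Tp.             (* pilot index assigned to user k *)

Definition ptp : R := p * Tp%:R.

Definition Pset (k : 'I_K) : {set 'I_K} := [set k' | pil k' == pil k].

Definition cAP (m : 'I_M) (k : 'I_K) : R :=
  Num.sqrt ptp * beta m k / (\sum_(k' in Pset k) ptp * beta m k' + sa2).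
Definition gammaAP (m : 'I_M) (k : 'I_K) : R :=
  ptp * beta m k ^+ 2 / (\sum_(k' in Pset k) ptp * beta m k' + sa2).
Definition Phi (k : 'I_K) : 'M[C]_N :=
  invmx (\sum_(k' in Pset k) (ptp%:C *: Rk k') + (ss2%:C)%:M).

Section Random.
Variables (d : measure_display) (Om : measurableType d).
Variable gAP : 'I_M -> 'I_K -> Om -> C.
Variable gS : 'I_K -> Om -> 'cV[C]_N.
Variable nP : 'I_M -> 'I_Tp -> Om -> C.       (* pilot noise at AP m, pilot t *)
Variable wP : 'I_Tp -> Om -> 'cV[C]_N.        (* pilot noise at gateway, pilot t *)

(* received (projected) pilot signals *)
Definition yAP (m : 'I_M) (k : 'I_K) (w : Om) : C :=
  (Num.sqrt ptp)%:C * (\sum_(k' in Pset k) gAP m k' w) + nP m (pil k) w.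
Definition yS (k : 'I_K) (w : Om) : 'cV[C]_N :=
  (Num.sqrt ptp)%:C *: (\sum_(k' in Pset k) gS k' w) + wP (pil k) w.

(* MMSE estimates *)
Definition ghatAP (m : 'I_M) (k : 'I_K) (w : Om) : C := (cAP m k)%:C * yAP m k w.
Definition ghatS (k : 'I_K) (w : Om) : 'cV[C]_N :=
  gbar k + (Num.sqrt ptp)%:C *:
    (Rk k *m Phi k *m (yS k w - (Num.sqrt ptp)%:C *: \sum_(k' in Pset k) gbar k')).

(* MRC: u_k = ghat_k, u_mk = ghat_mk;  z_kk' *)
Definition zz (k k' : 'I_K) (w : Om) : C :=
  cdot (ghatS k w) (gS k' w) + \sum_(m < M) (ghatAP m k w)^* * gAP m k' w.

Variable P : probability Om R.
Variable wS : Om -> 'cV[C]_N.                 (* data noise at gateway *)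
Variable wA : 'I_M -> Om -> C.                (* data noise at AP m *)
Variable Q : {set 'I_K}.                      (* active users *)
Variable rho : 'I_K -> R.                     (* data powers *)

Definition SINR (k : 'I_K) : R :=
  let S := rho k * sqmod (Ec P (zz k k)) in
  S / (\sum_(k' in Q) rho k' * Er P (fun w => sqmod (zz k k' w)) - S
       + Er P (fun w => sqmod (cdot (ghatS k w) (wS w)))
       + \sum_(m < M) Er P (fun w => sqmod ((ghatAP m k w)^* * wA m w))).

Definition rv_family
  (i : (('I_M * 'I_K) + 'I_K) + ((('I_M * 'I_Tp) + 'I_Tp) + (unit + 'I_M)))
  : @crv R d Om :=
  match i with
  | inl (inl (m, k)) => crv1 (gAP m k)
  | inl (inr k) => CRV (gS k)
  | inr (inl (inl (m, t))) => crv1 (nP m t)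
  | inr (inl (inr t)) => CRV (wP t)
  | inr (inr (inl _)) => CRV wS
  | inr (inr (inr m)) => crv1 (wA m)
  end.
End Random.

(* closed form of the SINR (as a complex number; it is real) *)
Definition SINR_num (rho : 'I_K -> R) (k : 'I_K) : C :=
  (rho k)%:C * (cdot (gbar k) (gbar k) + ptp%:C * \tr (Rk k *m Phi k *m Rk k)
                + \sum_(m < M) (gammaAP m k)%:C) ^+ 2.

Definition MI (Q : {set 'I_K}) (rho : 'I_K -> R) (k : 'I_K) : C :=
    \sum_(k' in Pset k :\ k) (rho k')%:C *
       `| cdot (gbar k) (gbar k') + ptp%:C * \tr (Rk k' *m Phi k *m Rk k)
          + \sum_(m < M) (cAP m k' / cAP m k * gammaAP m k)%:C | ^+ 2
  + \sum_(k' in ~: Pset k) (rho k')%:C * `| cdot (gbar k) (gbar k') | ^+ 2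
  + ptp%:C * \sum_(k' in Q) (rho k')%:C * cqf (gbar k') (Rk k *m Phi k *m Rk k) (gbar k')
  + \sum_(k' in Q) (rho k')%:C * cqf (gbar k) (Rk k') (gbar k)
  + ptp%:C * \sum_(k' in Q) (rho k')%:C * \tr (Rk k' *m Rk k *m Phi k *m Rk k)
  + \sum_(k' in Q) \sum_(m < M) (rho k' * gammaAP m k * beta m k')%:C.

Definition NO (k : 'I_K) : C :=
    ss2%:C * cdot (gbar k) (gbar k)
  + (ptp * ss2)%:C * \tr (Rk k *m Phi k *m Rk k)
  + (sa2 * \sum_(m < M) gammaAP m k)%:C.

Definition SINR_closed (Q : {set 'I_K}) (rho : 'I_K -> R) (k : 'I_K) : C :=
  SINR_num rho k / (MI Q rho k + NO k).
End Model.

Definition throughput (R : realType) (B : R) (Tp Tc : nat) (sinr : R) : R :=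
  B * (1 - Tp%:R / Tc%:R) * (ln (1 + sinr) / ln 2).

(* Main.v *)
(** All channels and noises are affine in one family of independent circularly
symmetric Gaussian vectors. Independence, given only on orthants, yields the
characteristic function of every complex linear form of the pooled family;
comparing it with its Taylor expansion at 0 gives the moments of order at most
four of these forms, and polarization turns them into Wick's formula. Stacking
the satellite and the access points, [z_kk' = (a + E)^H (b + H)] where [a], [b]
are the line-of-sight means and [E], [H] are the centred estimate and channel,
so with [S_XY] the covariance [E(X Y^H)]
[E z = a^H b + tr S_HE] and
[E|z|^2 = |E z|^2 + a^H S_HH a + b^H S_EE b + tr (S_EE S_HH)].
The covariances are [S_EE = p tau_p R_k Phi_k R_k] and
[S_HE = p tau_p R_k' Phi_k R_k] if the pilot is shared, [0] otherwise; summing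
over the users gives the closed form. *)

From Pilot Require Import Defs.
From HB Require Import structures.
From mathcomp Require Import all_boot all_order all_algebra.
From mathcomp Require Import all_classical all_reals all_analysis.
From mathcomp Require Import measurable_realfun complex.
From mathcomp Require Import ring lra.
Set Implicit Arguments. Unset Strict Implicit. Unset Printing Implicit Defensive.
Import Order.TTheory GRing.Theory Num.Theory.
Import numFieldNormedType.Exports.
Local Open Scope ring_scope.
Local Open Scope complex_scope.

(** * Real expectations *)

Section RealExpectation.
Local Open Scope classical_set_scope.
Local Open Scope ring_scope.
Context {R : realType} {d : measure_display} {Om : measurableType d}.
Variable P : probability Om R.
Implicit Types X Y W f : Om -> R.

(** [isCN] fixes a law only through its characteristic function: no density, no moment, not even the
    integrability of a channel is given, and the covariances [Rk k] may be singular. As [Er] passes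
    through [fine], a divergent expectation silently becomes a real number and linearity may fail;
    so every moment below travels with an integrability statement. The estimate of user [k] is
    correlated with the channel of each user on the same pilot, so [z] does not split into
    independent factors. Its power involves fourth-order products of dependent Gaussians, which is
    what forces Wick's formula; circular symmetry is what leaves a single trace term. Stacking the
    two receivers makes them add coherently inside [E z]. Outside it they contribute separately,
    because satellite and AP channels are uncorrelated and the APs have zero mean. Users fall into
    three classes: [k], whose coherent power is subtracted from the denominator; the other users of
    its pilot, whose coherent power remains as contamination; and the rest, for whom only the
    line-of-sight product survives in [E z]. *)

Definition rint X : Prop := P.-integrable setT (EFin \o X).

Lemma ErE X : Er P X = Rintegral P setT X.
Proof. by rewrite /Er unlock. Qed.

Lemma expectation_Er X : rint X -> ('E_P[X] = (Er P X)%:E)%E.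
Proof.
move=> iX; rewrite /Er fineK// unlock.
exact: integrable_fin_num.
Qed.

Lemma rintD X Y : rint X -> rint Y -> rint (fun w => X w + Y w).
Proof. by move=> iX iY; rewrite /rint; apply: (integrableD measurableT iX iY). Qed.

Lemma rintZ a X : rint X -> rint (fun w => a * X w).
Proof. by move=> iX; rewrite /rint; apply: (integrableZl measurableT a iX). Qed.

Lemma rintN X : rint X -> rint (fun w => - X w).
Proof.
move=> iX; have := rintZ (-1) iX; congr rint.
by apply/funext => w; rewrite mulN1r.
Qed.

Lemma rintB X Y : rint X -> rint Y -> rint (fun w => X w - Y w).
Proof. by move=> iX iY; apply: rintD => //; exact: rintN. Qed.

Lemma rint_le X Y : measurable_fun setT X -> (forall w, `|X w| <= Y w) ->
  rint Y -> rint X.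
Proof.
move=> mX XY iY; apply: (le_integrable measurableT _ _ iY).
  exact/measurable_EFinP.
by move=> w _ /=; rewrite lee_fin (le_trans (XY w))// ler_norm.
Qed.

Lemma rint_cst (a : R) : rint (fun=> a).
Proof. exact: finite_measure_integrable_cst. Qed.

Lemma rint_bounded X (c : R) : measurable_fun setT X ->
  (forall w, `|X w| <= c) -> rint X.
Proof. by move=> mX Xc; apply: (rint_le mX Xc); exact: rint_cst. Qed.

Lemma rint_sum (I : Type) (r : seq I) (Q : pred I) (X : I -> Om -> R) :
  (forall i, rint (X i)) -> rint (fun w => \sum_(i <- r | Q i) X i w).
Proof.
move=> iX; elim: r => [|i r IH].
  by have := rint_cst 0; congr rint; apply/funext => w; rewrite big_nil.
have [Qi|nQi] := boolP (Q i).
  have := rintD (iX i) IH; congr rint; apply/funext => w.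
  by rewrite big_cons Qi.
by move: IH; congr rint; apply/funext => w; rewrite big_cons (negbTE nQi).
Qed.

Lemma ErD X Y : rint X -> rint Y ->
  Er P (fun w => X w + Y w) = Er P X + Er P Y.
Proof. by move=> iX iY; rewrite !ErE RintegralD. Qed.

Lemma ErZ a X : rint X -> Er P (fun w => a * X w) = a * Er P X.
Proof. by move=> iX; rewrite !ErE RintegralZl. Qed.

Lemma ErN X : rint X -> Er P (fun w => - X w) = - Er P X.
Proof.
move=> iX; rewrite -mulN1r -ErZ//; congr (Er P _).
by apply/funext => w; rewrite mulN1r.
Qed.

Lemma ErB X Y : rint X -> rint Y ->
  Er P (fun w => X w - Y w) = Er P X - Er P Y.
Proof. by move=> iX iY; rewrite ErD ?ErN//; exact: rintN. Qed.

Lemma Er_cst (a : R) : Er P (fun=> a) = a.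
Proof. by rewrite /Er [X in fine X](expectation_cst P a). Qed.

Lemma Er_sum (I : Type) (r : seq I) (Q : pred I) (X : I -> Om -> R) :
  (forall i, rint (X i)) ->
  Er P (fun w => \sum_(i <- r | Q i) X i w) = \sum_(i <- r | Q i) Er P (X i).
Proof.
move=> iX; elim: r => [|i r IH].
  rewrite big_nil -[RHS](Er_cst 0); congr (Er P _).
  by apply/funext => w; rewrite big_nil.
rewrite big_cons; case: ifPn => Qi.
  rewrite -IH -ErD//; last exact: rint_sum.
  by congr (Er P _); apply/funext => w; rewrite big_cons Qi.
by rewrite -IH; congr (Er P _); apply/funext => w; rewrite big_cons (negbTE Qi).
Qed.

Lemma Er_indic (A : set Om) : measurable A -> Er P (\1_A) = fine (P A).
Proof. by move=> mA; rewrite /Er expectation_indic. Qed.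

Lemma Er_dominated (X : nat -> Om -> R) Y Z :
  (forall n, measurable_fun setT (X n)) -> measurable_fun setT Y -> rint Z ->
  (forall w, X n w @[n --> \oo] --> Y w) -> (forall n w, `|X n w| <= Z w) ->
  Er P (X n) @[n --> \oo] --> Er P Y.
Proof.
move=> mX mY iZ cX dX.
have [] := @dominated_convergence _ _ _ P _ measurableT
  (fun n => EFin \o X n) (EFin \o Y) (EFin \o Z).
- by move=> n; exact/measurable_EFinP.
- exact/measurable_EFinP.
- apply: aeW => w _; apply: cvg_EFin; last exact: cX.
  by near=> n.
- exact: iZ.
- by apply: aeW => w n _ /=; rewrite lee_fin.
move=> iY _ c.
have -> : Er P Y = fine (\int[P]_w (EFin \o Y) w) by rewrite /Er unlock.
rewrite [X in X @ _](_ : _ = fine \o (fun n => \int[P]_w (EFin \o X n) w)%E); last first.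
  by apply/funext => n; rewrite /Er unlock.
apply: fine_cvg; rewrite fineK//.
exact: integrable_fin_num.
Unshelve. all: by end_near. Qed.

End RealExpectation.

(** * Independence from the product rule on orthants *)

Section Decoupling.
Local Open Scope classical_set_scope.
Local Open Scope ring_scope.
Context {R : realType} {d : measure_display} {Om : measurableType d}.
Variable P : probability Om R.
Variables (G : set (set Om)) (W : Om -> R) (c kappa : R).
Hypothesis GI : setI_closed G.
Hypothesis Gm : G `<=` measurable.
Hypothesis mW : measurable_fun setT W.
Hypothesis Wb : forall w, `|W w| <= kappa.

(* The functions satisfying this identity form a vector space closed under
   bounded pointwise limits: from the indicators of a pi-system it spreads to
   all bounded functions measurable for the generated sigma-algebra. *)
Definition decoupled (f : Om -> R) : Prop :=
  Er P (fun w => W w * f w) = c * Er P f.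

Lemma decoupled_cvg (f_ : nat -> Om -> R) (f : Om -> R) (b : R) :
  (forall n, measurable_fun setT (f_ n)) -> measurable_fun setT f ->
  (forall n w, `|f_ n w| <= b) ->
  (forall w, f_ n w @[n --> \oo] --> f w) ->
  (forall n, decoupled (f_ n)) -> decoupled f.
Proof.
move=> mf_ mf fb cf df.
have cW : Er P (fun w => W w * f_ n w) @[n --> \oo] --> Er P (fun w => W w * f w).
  apply: (@Er_dominated _ _ _ _ _ _ (fun=> kappa * b)).
  - by move=> n; apply: measurable_funM.
  - exact: measurable_funM.
  - exact: rint_cst.
  - by move=> w; apply: cvgM; [exact: cvg_cst|exact: cf].
  - by move=> n w; rewrite normrM ler_pM.
have c1 : Er P (f_ n) @[n --> \oo] --> Er P f.
  by apply: (@Er_dominated _ _ _ _ _ _ (fun=> b)) => //; exact: rint_cst.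
have c2 : Er P (fun w => W w * f_ n w) @[n --> \oo] --> c * Er P f.
  by under eq_fun do rewrite df; apply: cvgM; [exact: cvg_cst|].
exact: (cvg_unique (@norm_hausdorff _ _) cW c2).
Qed.

Lemma decoupled_lin (I : Type) (r : seq I) (a : I -> R) (f : I -> Om -> R) :
  (forall i, measurable_fun setT (f i)) -> (forall i, exists b : R, forall w, `|f i w| <= b) ->
  (forall i, decoupled (f i)) -> decoupled (fun w => \sum_(i <- r) a i * f i w).
Proof.
move=> mf bf df.
have i1 i : rint P (f i) by have [b fb] := bf i; exact: rint_bounded fb.
have i2 i : rint P (fun w => W w * f i w).
  have [b fb] := bf i; apply: (@rint_bounded _ _ _ _ _ (kappa * b)).
    exact: measurable_funM.
  by move=> w; rewrite normrM ler_pM.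
rewrite /decoupled.
under [X in Er P X]eq_fun do rewrite mulr_sumr.
under [X in Er P X]eq_fun do under eq_bigr do rewrite mulrCA.
rewrite !Er_sum; try by move=> i; exact: rintZ.
rewrite mulr_sumr; apply: eq_bigr => i _.
by rewrite !ErZ// df mulrCA.
Qed.

(** An orthant has finite corners, so the whole space need not belong to the pi-system. The
    exhaustion [A_] supplies it as an increasing union, as Dynkin's theorem requires. *)
Variable A_ : nat -> set Om.
Hypothesis GA_ : forall n, G (A_ n).
Hypothesis ndA : {homo A_ : n m / (n <= m)%N >-> n `<=` m}.
Hypothesis UA : \bigcup_n A_ n = setT.
Hypothesis dG : forall A, G A -> decoupled (\1_A).

Lemma indic_bounded (A : set Om) w : `|\1_A w : R| <= 1.
Proof. by rewrite indicE; case: (_ \in _); rewrite ?normr1 ?normr0. Qed.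

Lemma cvg_indic_nd (F : nat -> set Om) :
  {homo F : n m / (n <= m)%N >-> n `<=` m} ->
  forall w, \1_(F n) w @[n --> \oo] --> (\1_(\bigcup_n F n) w : R).
Proof.
move=> ndF w; have [[n _ Fnw]|nF] := pselect ((\bigcup_n F n) w).
  apply: cvg_near_cst; near=> m; rewrite !indicE !mem_set//.
    by exists n.
  by apply: (ndF n) => //; near: m; exact: nbhs_infty_ge.
apply: cvg_near_cst; near=> m; rewrite !indicE !memNset//.
by move=> Fm; apply: nF; exists m.
Unshelve. all: by end_near. Qed.

(** Dynkin's pi-lambda theorem: the measurable sets with decoupled indicator are closed under
    increasing unions by dominated convergence and under proper differences by linearity. *)
Lemma decoupled_sigma A : <<s G >> A -> decoupled (\1_A).
Proof.
pose H := [set A | measurable A /\ decoupled (\1_A)].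
suff: <<s G >> `<=` H by move=> GH /GH[].
have ndH : ndseq_closed H.
  move=> F ndF HF; split.
    by apply: bigcup_measurable => n _; exact: (HF n).1.
  apply: (@decoupled_cvg (fun n => \1_(F n)) _ 1).
  - by move=> n; apply: measurable_indic; exact: (HF n).1.
  - by apply: measurable_indic; apply: bigcup_measurable => n _; exact: (HF n).1.
  - by move=> n w; exact: indic_bounded.
  - by apply: cvg_indic_nd => n m nm; apply/subsetPset; exact: ndF.
  - by move=> n; exact: (HF n).2.
have HT : H setT.
  rewrite -UA; apply: ndH => [n m nm|n].
    by apply/subsetPset; exact: ndA.
  by split; [exact: Gm|exact: dG].
apply: lambda_system_subset => //; last first.
  by move=> B GB; split; [exact: Gm|exact: dG].
split => // B C CB [mB dB] [mC dC]; split; first exact: measurableD.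
have -> : (\1_(B `\` C) : Om -> R) =
    fun w => \sum_(i <- [:: true; false]) (if i then 1 else -1) *
      (if i then \1_B else \1_C) w.
  apply/funext => w; rewrite !big_cons big_nil /= addr0 mul1r mulN1r.
  rewrite !indicE in_setD; case: (boolP (w \in C)) => wC /=.
    by rewrite (mem_set (CB _ (set_mem wC))) subrr.
  by rewrite andbT subr0.
apply: decoupled_lin; case=> //; try exact: measurable_indic;
  by exists 1 => w; exact: indic_bounded.
Qed.

Import HBNNSimple.

Lemma g_sigma_measurable (A : set Om) : <<s G >> A -> measurable A.
Proof.
by apply: smallest_sub => //; exact: sigma_algebra_measurable.
Qed.

Lemma g_sigma_measurable_fun (f : Om -> R) :
  measurable_fun setT (f : g_sigma_algebraType G -> R) -> measurable_fun setT f.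
Proof. by move=> mf _ Y mY; apply: g_sigma_measurable; exact: mf. Qed.

Lemma decoupled_nneg (f : Om -> R) (b : R) :
  measurable_fun setT (f : g_sigma_algebraType G -> R) ->
  (forall w, 0 <= f w <= b) -> decoupled f.
Proof.
move=> mf fb.
have mf' : measurable_fun setT (EFin \o (f : g_sigma_algebraType G -> R)).
  exact/measurable_EFinP.
(* The approximation is built over [g_sigma_algebraType G], not over [Om]: the level sets of the
   simple functions then lie in [<<s G >>], where indicators are already decoupled. *)
pose h := nnsfun_approx measurableT mf'.
have mh n : measurable_fun setT (h n : g_sigma_algebraType G -> R).
  exact: measurable_funP.
have ch w : h n w @[n --> \oo] --> f w.
  have := @cvg_nnsfun_approx _ _ _ _ measurableT _ mf' _ w I.
  move=> /(_ _)/fine_cvgP[|_ //].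
  by move=> x _; rewrite /= lee_fin; case/andP: (fb x).
have hf n w : h n w <= f w.
  have := nondecreasing_cvgn_le _ (cvgP _ (ch w)) n.
  rewrite (cvg_lim _ (ch w))//; apply => m k mk.
  exact: (lefP _ _ (nd_nnsfun_approx measurableT mf' mk)).
apply: (@decoupled_cvg h f b) => //.
- by move=> n; exact: g_sigma_measurable_fun.
- exact: g_sigma_measurable_fun.
- by move=> n w; rewrite ger0_norm// (le_trans (hf n w))//; case/andP: (fb w).
move=> n.
have -> : (h n : Om -> R) =
    fun w => \sum_(y <- finmap.enum_fset (fset_set (range (h n)))) y * \1_(h n @^-1` [set y]) w.
  by apply/funext => w; rewrite [LHS]fimfunE fsbig_finite.
have hG y : <<s G >> (h n @^-1` [set y]).
  by have := mh n measurableT [set y] (measurable_set1 y); rewrite setTI.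
apply: (@decoupled_lin _ _ (fun y => y) (fun y => \1_(h n @^-1` [set y]))).
- by move=> y; apply: measurable_indic; exact: g_sigma_measurable.
- by move=> y; exists 1 => w; exact: indic_bounded.
- by move=> y; exact: decoupled_sigma.
Qed.

Lemma decoupled_measurable (f : Om -> R) (b : R) :
  measurable_fun setT (f : g_sigma_algebraType G -> R) ->
  (forall w, `|f w| <= b) -> decoupled f.
Proof.
move=> mf fb.
(* Shifting by the bound [b] reduces to the nonnegative case; the constant subtracted afterwards is
   itself decoupled. *)
have -> : f = fun w => \sum_(i <- [:: true; false]) (if i then 1 else -b) *
      (if i then (fun w => f w + b) else cst 1) w.
  apply/funext => w; rewrite !big_cons big_nil /= addr0 mul1r mulr1.
  by rewrite addrK.
have mfb : measurable_fun setT (fun w : g_sigma_algebraType G => f w + b).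
  exact: measurable_funD.
have fb2 w : 0 <= f w + b <= b + b.
  by have := fb w; rewrite ler_norml => /andP[? ?]; rewrite -lerBlDr sub0r lerD2r; apply/andP.
apply: decoupled_lin; case=> //.
- exact: g_sigma_measurable_fun.
- exists (b + b) => w; rewrite ger0_norm; by case/andP: (fb2 w).
- by exists 1 => w; rewrite normr1.
- exact: (@decoupled_nneg _ (b + b)).
- by apply: (@decoupled_nneg _ 1) => // w; rewrite ler01 lexx.
Qed.

End Decoupling.

Section Independence.
Local Open Scope classical_set_scope.
Local Open Scope ring_scope.
Context {R : realType} {d : measure_display} {Om : measurableType d}.
Variable P : probability Om R.
Local Notation C := R[i].

(** * Orthants of a random vector: pi-system, exhaustion and generated sigma-algebra *)

Section BelowSets.
Variable X : @crv R d Om.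
Hypothesis mX : cmeas (crv_fun X).

Definition below_sets : set (set Om) := range (below X).

Lemma below_sets_setI : setI_closed below_sets.
Proof.
move=> _ _ [a _ <-] [b _ <-].
exists (fun j => (Num.min (a j).1 (b j).1, Num.min (a j).2 (b j).2)) => //.
apply/seteqP; split => [w ab|w [ha hb] j] /=.
  by split=> j; have := ab j; rewrite /= !le_min => -[/andP[? ?] /andP[? ?]].
by rewrite !le_min; have [-> ->] := ha j; have [-> ->] := hb j.
Qed.

Lemma below_sets_measurable : below_sets `<=` measurable.
Proof.
move=> _ [a _ <-].
rewrite (_ : below X a = \bigcap_(j in [set: 'I_(crv_dim X)])
   ([set w | complex.Re (crv_fun X w j 0) <= (a j).1] `&`
    [set w | complex.Im (crv_fun X w j 0) <= (a j).2])); last first.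
  by apply/seteqP; split => [w h j _|w h j]; [exact: h|exact: h].
apply: fin_bigcap_measurable => // j _.
have [m1 m2] := mX j; apply: measurableI.
  by have := measurable_fun_le measurableT m1 (measurable_cst (a j).1); rewrite setTI.
by have := measurable_fun_le measurableT m2 (measurable_cst (a j).2); rewrite setTI.
Qed.

Definition below_exhaust (n : nat) : set Om := below X (fun=> (n%:R, n%:R)).

Lemma below_exhaust_in n : below_sets (below_exhaust n).
Proof. by exists (fun=> (n%:R, n%:R)). Qed.

Lemma below_exhaust_nd : {homo below_exhaust : n m / (n <= m)%N >-> n `<=` m}.
Proof.
move=> n m nm w h j /=; have [h1 h2] := h j.
by split; [apply: (le_trans h1)|apply: (le_trans h2)]; rewrite ler_nat.
Qed.

Lemma eventually_below (w : Om) : exists n : nat, forall m, (n <= m)%N -> below_exhaust m w.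
Proof.
pose b := \sum_j (`|complex.Re (crv_fun X w j 0)| + `|complex.Im (crv_fun X w j 0)|).
exists (Num.truncn b).+1 => m nm j.
have bm : b <= m%:R.
  by rewrite (le_trans (ltW (truncnS_gt b)))// ler_nat.
have : `|complex.Re (crv_fun X w j 0)| + `|complex.Im (crv_fun X w j 0)| <= b.
  by rewrite /b (bigD1 j)//= lerDl sumr_ge0.
move=> jb; split => /=; rewrite (le_trans _ bm)// (le_trans _ jb)//.
  by rewrite (le_trans (ler_norm _))// lerDl.
by rewrite (le_trans (ler_norm _))// lerDr.
Qed.

Lemma below_exhaust_cover : \bigcup_n below_exhaust n = setT.
Proof.
apply/seteqP; split => // w _.
by have [n hn] := eventually_below w; exists n => //; exact: hn.
Qed.

(** A half-space bounding one coordinate is not an orthant, since orthants bound all coordinates. It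
    is a countable union of orthants [aof r n], whose other bounds grow with [n]. *)
Lemma coord_sigma_measurable (g : Om -> R) (aof : R -> nat -> nat -> R * R) :
  (forall r w, g w <= r <-> exists n, below X (aof r n) w) ->
  measurable_fun setT (g : g_sigma_algebraType below_sets -> R).
Proof.
move=> gr.
(* The generators taken on the line are the open half-lines above [r], whose preimages are
   complements of such unions. *)
apply: (measurability _ (RGenOInfty.measurableE R)) => _ [_ [r ->] <-].
rewrite setTI (_ : _ @^-1` _ = ~` \bigcup_n below X (aof r n)).
  apply: measurableC; apply: bigcup_measurable => n _.
  by apply: sub_sigma_algebra; exists (aof r n).
apply/seteqP; split => [w|w nw] /=.
  rewrite in_itv/= andbT => rg [n _ h].
  have /gr : exists n, below X (aof r n) w by exists n.
  by rewrite leNgt rg.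
rewrite in_itv/= andbT ltNge; apply/negP => /gr[n h].
by apply: nw; exists n.
Qed.

Lemma Re_coord_sigma_measurable (j : 'I_(crv_dim X)) :
  measurable_fun setT
    ((fun w => complex.Re (crv_fun X w j 0)) : g_sigma_algebraType below_sets -> R).
Proof.
apply: (@coord_sigma_measurable _
  (fun r n i => (if i == j then r else n%:R, n%:R))) => r w; split.
  move=> gr; have [n hn] := eventually_below w; exists n => i /=.
  have [h1 h2] := hn n (leqnn _) i; split=> //.
  by case: eqP => [/val_inj ->|_].
by move=> [n /(_ j)[]]; rewrite eqxx.
Qed.

Lemma Im_coord_sigma_measurable (j : 'I_(crv_dim X)) :
  measurable_fun setT
    ((fun w => complex.Im (crv_fun X w j 0)) : g_sigma_algebraType below_sets -> R).
Proof.
apply: (@coord_sigma_measurable _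
  (fun r n i => (n%:R, if i == j then r else n%:R))) => r w; split.
  move=> gr; have [n hn] := eventually_below w; exists n => i /=.
  have [h1 h2] := hn n (leqnn _) i; split=> //.
  by case: eqP => [/val_inj ->|_].
by move=> [n /(_ j)[]]; rewrite eqxx.
Qed.

End BelowSets.

(** * Characteristic function of a sum of independent variables *)

Section CharacteristicFunction.
Variables (I : finType) (F : I -> @crv R d Om).
Hypothesis mF : forall i, cmeas (crv_fun (F i)).
Hypothesis indF : mutually_independent P F.
Variables (Y : I -> Om -> R) (e : I -> R).
Hypothesis mY : forall i,
  measurable_fun setT (Y i : g_sigma_algebraType (below_sets (F i)) -> R).
Hypothesis cosY : forall i, Er P (fun w => cos (Y i w)) = e i.
Hypothesis sinY : forall i, Er P (fun w => sin (Y i w)) = 0.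

Local Notation S J w := (\sum_(i in J) Y i w).
Local Notation ind J a w := (\prod_(i in ~: J) \1_(below (F i) (a i)) w).

Lemma prod_indic (A : I -> set Om) (Q : pred I) w :
  \prod_(i | Q i) \1_(A i) w = \1_(\bigcap_(i in [set i | Q i]) A i) w :> R.
Proof.
have [h|h] := pselect ((\bigcap_(i in [set i | Q i]) A i) w).
  rewrite [RHS]indicE mem_set//= big1// => i Qi.
  by rewrite indicE mem_set//; exact: h.
rewrite [RHS]indicE memNset//=.
have [i [Qi nA]] : exists i, Q i /\ ~ A i w.
  apply/not_existsP => hn; apply: h => i /= Qi.
  by have := hn i; apply: contra_notP.
by rewrite (bigD1 i)//= indicE memNset// mul0r.
Qed.

(* One at a time, the indicator of the orthant event of the variable [i] is
   traded for [exp (i Y_i)]; the orthants of the remaining variables stay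
   arbitrary, which is what makes the next trade possible. *)
Lemma cos_sin_sum (J : {set I}) (a : I -> nat -> R * R) :
  let p := \prod_(i in ~: J) Er P (\1_(below (F i) (a i))) in
  Er P (fun w => cos (S J w) * ind J a w) = \prod_(i in J) e i * p /\
  Er P (fun w => sin (S J w) * ind J a w) = 0.
Proof.
move=> p; rewrite {}/p.
have mYi i : measurable_fun setT (Y i).
  exact: (g_sigma_measurable_fun (below_sets_measurable (@mF i)) (@mY i)).
have mb i b : measurable (below (F i) b).
  by apply: (below_sets_measurable (@mF i)); exists b.
have [n] := ubnP #|J|; elim: n J a => // n IH J a.
(* With nothing traded yet, the claim is the product rule on orthants itself. *)
have [->|[i0 Ji0]] := set_0Vmem J.
  move=> _; under [X in Er P X]eq_fun do rewrite big_set0 cos0 mul1r.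
  under [X in _ /\ Er P X = _]eq_fun do rewrite big_set0 sin0 mul0r.
  rewrite Er_cst big_set0 mul1r; split=> //.
  under [X in Er P X]eq_fun do rewrite prod_indic.
  rewrite Er_indic; last first.
    by apply: fin_bigcap_measurable => // i _.
  rewrite (_ : \bigcap_(i in _) _ = \bigcap_i below (F i) (a i)); last first.
    by apply/seteqP; split => w h i _; apply: h => //=; rewrite !inE.
  rewrite indF.
  have -> : (\prod_i P (below (F i) (a i)) =
      (\prod_i (Er P (\1_(below (F i) (a i)))))%:E)%E.
    elim/big_ind2 : _ => // [x1 x2 y1 y2 -> ->|i _]; first by rewrite EFinM.
    by rewrite Er_indic// fineK// fin_num_measure.
  by rewrite /=; apply: eq_bigl => i; rewrite !inE.
rewrite ltnS (cardsD1 i0) Ji0 add1n => Jn.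
set J' := J :\ i0 in Jn *.
have JJ' : J = i0 |: J' by rewrite finset.setD1K.
have notJ' : i0 \notin J' by rewrite !inE eqxx.
have CJ' (T : comRingType) (f : I -> T) :
    \prod_(i in ~: J') f i = f i0 * \prod_(i in ~: J) f i.
  rewrite (bigD1 i0) ?inE ?eqxx//=; congr (_ * _).
  apply: eq_bigl => i; rewrite !inE; case: eqP => [->|]; rewrite ?andbF ?andbT//.
  by rewrite Ji0.
have SJ w : S J w = Y i0 w + S J' w.
  by rewrite JJ' big_setU1.
(* [W1] and [W2] are the real and imaginary parts of what remains once the variable [i0] is taken
   out. The induction hypothesis decouples them from the orthants of [i0], with constants [c1] and
   [0]. *)
pose c1 := \prod_(i in J') e i * \prod_(i in ~: J) Er P (\1_(below (F i) (a i))).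
pose W1 w := cos (S J' w) * ind J a w.
pose W2 w := sin (S J' w) * ind J a w.
have ind01 w : `|ind J a w : R| <= 1.
  by rewrite prod_indic; exact: indic_bounded.
have mind : measurable_fun setT (fun w => ind J a w : R).
  under eq_fun do rewrite prod_indic.
  by apply: measurable_indic; apply: fin_bigcap_measurable.
have mS : measurable_fun setT (fun w => S J' w).
  under eq_fun do rewrite big_mkcond /=.
  by apply: measurable_sum => i; case: (i \in J').
have mW1 : measurable_fun setT W1.
  apply: measurable_funM => //.
  apply: measurableT_comp => //.
  by apply: continuous_measurable_fun; exact: continuous_cos.
have mW2 : measurable_fun setT W2.
  apply: measurable_funM => //.
  apply: measurableT_comp => //.
  by apply: continuous_measurable_fun; exact: continuous_sin.
have cos1 x : `|cos x : R| <= 1.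
  by rewrite ler_norml cos_geN1 cos_le1.
have sin1 x : `|sin x : R| <= 1.
  by rewrite ler_norml sin_geN1 sin_le1.
have W1b w : `|W1 w| <= 1 by rewrite normrM -[leRHS]mulr1 ler_pM.
have W2b w : `|W2 w| <= 1 by rewrite normrM -[leRHS]mulr1 ler_pM.
have dW A : below_sets (F i0) A -> decoupled P W1 c1 (\1_A) /\ decoupled P W2 0 (\1_A).
  move=> [b _ <-].
  (* The corner at [i0] is free in the induction hypothesis for [J']; setting it to [b] tests [W1]
     and [W2] against an arbitrary orthant of [i0]. *)
  pose a' i := if i == i0 then b else a i.
  have indE w : ind J' a' w = \1_(below (F i0) b) w * ind J a w :> R.
    rewrite CJ' /a' eqxx; congr (_ * _); apply: eq_bigr => i.
    by rewrite !inE; case: eqP => // -> /[!Ji0].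
  have [h1 h2] := IH J' a' Jn; split; rewrite /decoupled.
    transitivity (Er P (fun w => cos (S J' w) * ind J' a' w)).
      by congr (Er P _); apply/funext => w; rewrite indE /W1 -mulrA [in LHS](mulrC (ind J a w)).
    rewrite h1 CJ' {1}/a' eqxx /c1 -mulrA; congr (_ * _).
    rewrite mulrC; congr (_ * _); apply: eq_bigr => i.
    by rewrite !inE /a'; case: eqP => // -> /[!Ji0].
  rewrite mul0r -[RHS]h2.
  by congr (Er P _); apply/funext => w; rewrite indE /W2 -mulrA [in LHS](mulrC (ind J a w)).
have dec (W : Om -> R) (c : R) (f : R -> R) : measurable_fun setT W -> (forall w, `|W w| <= 1) ->
    (forall A, below_sets (F i0) A -> decoupled P W c (\1_A)) ->
    measurable_fun setT f -> (forall x, `|f x| <= 1) ->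
    Er P (fun w => W w * f (Y i0 w)) = c * Er P (fun w => f (Y i0 w)).
  move=> mW Wb dWc mf fb.
  apply: (@decoupled_measurable _ _ _ _ (below_sets (F i0)) W c 1 _ _ mW Wb
     (below_exhaust (F i0)) _ _ _ (@dWc) (fun w => f (Y i0 w)) 1) => //.
  - exact: below_sets_setI.
  - exact: below_sets_measurable.
  - exact: below_exhaust_in.
  - exact: below_exhaust_nd.
  - exact: below_exhaust_cover.
  - exact: (measurableT_comp mf (@mY i0)).
have mcos : measurable_fun setT (@cos R).
  by apply: continuous_measurable_fun; exact: continuous_cos.
have msin : measurable_fun setT (@sin R).
  by apply: continuous_measurable_fun; exact: continuous_sin.
have dW1 A GA := (@dW A GA).1; have dW2 A GA := (@dW A GA).2.
have h1 := dec _ _ _ mW1 W1b (@dW1) mcos cos1.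
have h2 := dec _ _ _ mW1 W1b (@dW1) msin sin1.
have h3 := dec _ _ _ mW2 W2b (@dW2) mcos cos1.
have h4 := dec _ _ _ mW2 W2b (@dW2) msin sin1.
have rW (W : Om -> R) (f : R -> R) : measurable_fun setT W -> (forall w, `|W w| <= 1) ->
    measurable_fun setT f -> (forall x, `|f x| <= 1) ->
    rint P (fun w => W w * f (Y i0 w)).
  move=> mW Wb mf fb; apply: (@rint_bounded _ _ _ _ _ 1).
    by apply: measurable_funM => //; exact: measurableT_comp.
  by move=> w; rewrite normrM -[leRHS]mulr1 ler_pM.
rewrite cosY in h1 h3; rewrite sinY in h2 h4.
(* By the addition formulas only the product [W1 * cos] survives: terms with [W2] carry the constant
   [0], and [W1 * sin] carries the vanishing expectation of [sin (Y i0)]. *)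
split.
  under [X in Er P X]eq_fun => w.
    rewrite SJ cosD (_ : _ * _ = W1 w * cos (Y i0 w) - W2 w * sin (Y i0 w)).
      over.
    by rewrite /W1 /W2; ring.
  rewrite ErB; try exact: rW.
  rewrite h1 h4 mul0r subr0 /c1.
  rewrite [in RHS]JJ' big_setU1//= -JJ'; ring.
under [X in Er P X]eq_fun => w.
  rewrite SJ sinD (_ : _ * _ = W1 w * sin (Y i0 w) + W2 w * cos (Y i0 w)).
    over.
  by rewrite /W1 /W2; ring.
rewrite ErD; try exact: rW.
by rewrite h2 h3 mulr0 mul0r addr0.
Qed.

Lemma Er_cos_sum : Er P (fun w => cos (\sum_i Y i w)) = \prod_i e i.
Proof.
(* No orthant is left when all variables are traded, so the corner [(0, 0)] is arbitrary. *)
have [h _] := cos_sin_sum [set: I] (fun _ _ => (0, 0)).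
move: h; rewrite [X in _ * X]big1 => [|i]; last by rewrite !inE.
rewrite mulr1.
rewrite (eq_bigl predT); last by move=> i; rewrite !inE.
move=> <-; congr (Er P _); apply/funext => w.
rewrite finset.setCT big_set0 mulr1; congr cos.
by rewrite [RHS]big_mkcond; apply: eq_bigr => i _; rewrite inE.
Qed.

Lemma Er_sin_sum : Er P (fun w => sin (\sum_i Y i w)) = 0.
Proof.
have [_ h] := cos_sin_sum [set: I] (fun _ _ => (0, 0)).
rewrite -[RHS]h; congr (Er P _); apply/funext => w.
rewrite finset.setCT big_set0 mulr1; congr sin.
by rewrite [RHS]big_mkcond; apply: eq_bigr => i _; rewrite inE.
Qed.

End CharacteristicFunction.
End Independence.

(** * Moments of order at most four from the characteristic function *)

Section MomentsFromCharacteristicFunction.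
Local Open Scope classical_set_scope.
Local Open Scope ring_scope.
Context {R : realType}.

(** Derivatives at 0 are turned into limits along sequences because dominated convergence and
    Fatou's lemma are applied to sequences of functions. *)
Lemma derive0_seq (f : R -> R) (l : R) (u : nat -> R) :
  is_derive (0 : R) (1 : R) f l -> f 0 = 0 -> (forall n, u n != 0) ->
  u n @[n --> \oo] --> (0 : R) -> f (u n) / u n @[n --> \oo] --> l.
Proof.
move=> [df dl] f0 un0 u0.
have c : h^-1 *: ((f \o shift 0) (h *: (1 : R)) - f 0) @[h --> (0:R)^'] --> l.
  by rewrite -dl; exact: df.
rewrite (_ : (fun n => _) =
    (fun h : R => h^-1 *: ((f \o shift 0) (h *: (1 : R)) - f 0)) \o u); last first.
  apply/funext => n /=.
  by rewrite f0 subr0 addr0 /GRing.scale/= mulr1 mulrC.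
apply: cvg_comp c => A nA.
have h : \forall n \near \oo, u n != 0 -> A (u n) by exact: (u0 _ nA).
by apply: filterS h => n; apply; exact: un0.
Qed.

Lemma norm_sin_le (x : R) : `|sin x| <= `|x|.
Proof.
wlog x0 : x / 0 <= x.
  move=> H; have [x0|/ltW x0] := leP 0 x; first exact: H.
  by rewrite -(normrN x) -(normrN (sin x)) -sinN; apply: H; rewrite oppr_ge0.
have [c _] := @MVT_segment R sin cos 0 x x0 (fun y _ => is_derive_sin y)
   (continuous_subspaceT (@continuous_sin R)).
rewrite sin0 !subr0 => ->; rewrite normrM -[leRHS]mul1r ler_wpM2r//.
by rewrite ler_norml cos_geN1 cos_le1.
Qed.

Lemma cvg_exprn (u : nat -> R) (l : R) k :
  u n @[n --> \oo] --> l -> u n ^+ k @[n --> \oo] --> l ^+ k.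
Proof.
move=> ul; elim: k => [|k IH]; first exact: cvg_cst.
by rewrite exprS; under eq_fun do rewrite exprS; exact: cvgM.
Qed.

Lemma harmonic_neq0 n : (harmonic n : R) != 0.
Proof. by rewrite /harmonic/= invr_eq0 pnatr_eq0. Qed.

Lemma cvg_sin_quotient (x : R) :
  sin (harmonic n * x) / harmonic n @[n --> \oo] --> x.
Proof.
apply: (@derive0_seq (fun s => sin (s * x)) x harmonic); last 3 first.
- by rewrite mul0r sin0.
- exact: harmonic_neq0.
- exact: cvg_harmonic.
have h : is_derive (0:R) (1:R) (fun s : R => s * x) x.
  apply: is_derive_eq.
  by rewrite scaler0 add0r /GRing.scale/= mulr1.
have := @is_derive1_comp R sin (fun s : R => s * x) 0 (cos (0 * x)) x
  (is_derive_sin _) h.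
by rewrite mul0r cos0 mul1r.
Qed.

Lemma cvg_expR_quotient (v : R) :
  (1 - expR (- (harmonic n ^+ 2 * v))) / harmonic n ^+ 2 @[n --> \oo] --> v.
Proof.
apply: (@derive0_seq (fun s => 1 - expR (- (s * v))) v (fun n => harmonic n ^+ 2)); last 3 first.
- by rewrite mul0r oppr0 expR0 subrr.
- by move=> n; rewrite expf_neq0// harmonic_neq0.
- rewrite -[X in _ --> X](mulr0 0).
  by apply: cvgM; exact: cvg_harmonic.
have h : is_derive (0:R) (1:R) (fun s : R => - (s * v)) (- v).
  apply: is_derive_eq.
  by rewrite scaler0 add0r /GRing.scale/= mulr1.
have h2 := @is_derive1_comp R expR (fun s : R => - (s * v)) 0 (expR (- (0 * v))) (-v)
  (is_derive_expR _) h.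
rewrite mul0r oppr0 expR0 mul1r in h2.
have h3 : is_derive (0:R) (1:R)
    ((cst 1 : R -> R) - (expR \o (fun s : R => - (s * v)))) (0 - - v).
  exact: is_deriveB.
by rewrite sub0r opprK in h3.
Qed.

Context {d : measure_display} {Om : measurableType d}.
Variable P : probability Om R.
Variables (U : Om -> R) (v : R).
Hypothesis mU : measurable_fun setT U.
Hypothesis cosU : forall s : R, Er P (fun w => cos (s * U w)) = expR (- (s ^+ 2 * v) / 2).
Hypothesis sinU : forall s : R, Er P (fun w => sin (s * U w)) = 0.

(* [1 - cos x = 2 sin^2 (x/2)], [3 - 4 cos x + cos (2x) = 8 sin^4 (x/2)] and
   [2 sin x - sin (2x) = 4 sin x sin^2 (x/2)]: the expectations of [a^2], [a^4]
   and [b a^2] are read off the characteristic function, while [a] and [b] are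
   dominated by [`|U|] and tend to [U / 2] and [U]. *)
Let a n w : R := sin (harmonic n * (U w / 2)) / harmonic n.
Let b n w : R := sin (harmonic n * U w) / harmonic n.
Let q n : R := expR (- (harmonic n ^+ 2 * v) / 2).

Let msin : measurable_fun setT (@sin R).
Proof. by apply: continuous_measurable_fun; exact: continuous_sin. Qed.

Let mcos : measurable_fun setT (@cos R).
Proof. by apply: continuous_measurable_fun; exact: continuous_cos. Qed.

Let msc (s : R) : measurable_fun setT (fun w => s * U w).
Proof. exact: measurable_funM. Qed.

Let rcos (s : R) : rint P (fun w => cos (s * U w)).
Proof.
apply: (@rint_bounded _ _ _ _ _ 1); first exact: measurableT_comp.
by move=> w; rewrite ler_norml cos_geN1 cos_le1.
Qed.

Let rsin (s : R) : rint P (fun w => sin (s * U w)).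
Proof.
apply: (@rint_bounded _ _ _ _ _ 1); first exact: measurableT_comp.
by move=> w; rewrite ler_norml sin_geN1 sin_le1.
Qed.

Let hn n : (harmonic n : R) != 0 := harmonic_neq0 n.

Let sin_half x : sin (x / 2) ^+ 2 = (1 - cos x) / 2 :> R.
Proof.
have -> : cos x = 1 - 2 * sin (x / 2) ^+ 2.
  have -> : cos x = cos (x / 2 + x / 2) by congr cos; field.
  by rewrite cosD -!expr2 cos2sin2; ring.
by field.
Qed.

Let a2E n w : a n w ^+ 2 = (1 - cos (harmonic n * U w)) / 2 / harmonic n ^+ 2.
Proof. by rewrite /a mulrA expr_div_n sin_half. Qed.

Let cos2x x : cos (2 * x) = 2 * cos x ^+ 2 - 1 :> R.
Proof.
have -> : 2 * x = x + x by ring.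
by rewrite cosD -!expr2 sin2cos2; ring.
Qed.

Let sin2x x : sin (2 * x) = 2 * sin x * cos x :> R.
Proof.
have -> : 2 * x = x + x by ring.
by rewrite sinD; ring.
Qed.

Let a4E n w : a n w ^+ 4 =
  (3 - 4 * cos (harmonic n * U w) + cos ((2 * harmonic n) * U w)) / 8 / harmonic n ^+ 4.
Proof.
rewrite (_ : 4 = 2 * 2)%N// !exprM a2E -(mulrA 2) cos2x.
by field; exact: hn.
Qed.

Let ba2E n w : b n w * a n w ^+ 2 =
  (2 * sin (harmonic n * U w) - sin ((2 * harmonic n) * U w)) / 4 / harmonic n ^+ 3.
Proof.
rewrite a2E /b -(mulrA 2) sin2x.
by field; exact: hn.
Qed.

Let a_le n w : `|a n w| <= `|U w|.
Proof.
rewrite /a normrM normfV ler_pdivrMr ?normr_gt0//.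
rewrite (le_trans (norm_sin_le _))// !normrM mulrC ler_pM2r ?normr_gt0//.
by rewrite normfV (@ger0_norm _ 2)// ler_pdivrMr// ler_peMr// ler1n.
Qed.

Let b_le n w : `|b n w| <= `|U w|.
Proof.
rewrite /b normrM normfV ler_pdivrMr ?normr_gt0//.
by rewrite (le_trans (norm_sin_le _))// normrM mulrC.
Qed.

Let ma n : measurable_fun setT (a n).
Proof.
apply: measurable_funM => //; apply: measurableT_comp => //.
by apply: measurable_funM => //; exact: measurable_funM.
Qed.

Let mb n : measurable_fun setT (b n).
Proof. by apply: measurable_funM => //; exact: measurableT_comp. Qed.

Let cvg_a w : a n w @[n --> \oo] --> U w / 2.
Proof. exact: cvg_sin_quotient. Qed.

Let cvg_b w : b n w @[n --> \oo] --> U w.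
Proof. exact: cvg_sin_quotient. Qed.

Let Er_a2 n : Er P (fun w => a n w ^+ 2) = (1 - q n) / harmonic n ^+ 2 / 2.
Proof.
under [X in Er P X]eq_fun do rewrite a2E -mulrA mulrC.
by rewrite ErZ ?ErB ?Er_cst ?cosU; [rewrite /q; field; exact: hn|exact: rint_cst|
  exact: rcos|apply: rintB; [exact: rint_cst|exact: rcos]].
Qed.

Let q4 n : expR (- ((2 * harmonic n) ^+ 2 * v) / 2) = q n ^+ 4.
Proof. by rewrite /q -expRM_natl; congr expR; field. Qed.

(** The characteristic function at twice the argument is [q ^ 4], and [3 - 4 q + q^4 = (1 - q)^2
    (q^2 + 2 q + 3)]: the double root at [q = 1] absorbs the division by the fourth power of
    [harmonic n]. *)
Let Er_a4 n : Er P (fun w => a n w ^+ 4) =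
  ((1 - q n) / harmonic n ^+ 2) ^+ 2 * (q n ^+ 2 + 2 * q n + 3) / 8.
Proof.
under [X in Er P X]eq_fun do rewrite a4E -mulrA mulrC.
rewrite ErZ; last first.
  apply: rintD => //; apply: rintB; first exact: rint_cst.
  exact: rintZ.
rewrite ErD//; last by apply: rintB; [exact: rint_cst|exact: rintZ].
rewrite ErB; [|exact: rint_cst|exact: rintZ].
by rewrite ErZ// Er_cst !cosU q4 -/(q n); field; exact: hn.
Qed.

Let Er_ba2 n : Er P (fun w => b n w * a n w ^+ 2) = 0.
Proof.
under [X in Er P X]eq_fun do rewrite ba2E -mulrA mulrC.
rewrite ErZ; last by apply: rintB => //; exact: rintZ.
by rewrite ErB//; [rewrite ErZ// !sinU; ring|exact: rintZ].
Qed.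

Let cvg_q2 : ((1 - q n) / harmonic n ^+ 2 : R) @[n --> \oo] --> (v / 2 : R).
Proof.
have := @cvg_expR_quotient (v / 2).
by under eq_fun do rewrite mulrA -mulNr.
Qed.

Let cvg_q : q n @[n --> \oo] --> (1 : R).
Proof.
have u0 : - (harmonic n ^+ 2 * v) / 2 @[n --> \oo] --> (- (0 * 0 * v) / 2 : R).
  apply: cvgM; last exact: cvg_cst.
  apply: cvgN; apply: cvgM; last exact: cvg_cst.
  by under eq_fun do rewrite expr2; apply: cvgM; exact: cvg_harmonic.
rewrite !mul0r oppr0 mul0r in u0.
have := continuous_cvg _ (@continuous_expR R 0) u0.
by rewrite expR0; apply.
Qed.

Let cvg_Er_a4 : Er P (fun w => a n w ^+ 4) @[n --> \oo] --> (3 * v ^+ 2 / 16 : R).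
Proof.
under eq_fun do rewrite Er_a4.
(* At [q = 1] the cofactor is 6, so the limit is [(v / 2)^2 * 6 / 8]. *)
rewrite (_ : 3 * v ^+ 2 / 16 = (v / 2 * (v / 2)) * (1 * 1 + 2 * 1 + 3) / 8); last by field.
apply: cvgM; last exact: cvg_cst.
under eq_fun do rewrite 2!expr2.
apply: cvgM; first exact: cvgM.
apply: cvgD; last exact: cvg_cst.
by apply: cvgD; apply: cvgM => //; exact: cvg_cst.
Qed.

(* Fatou's lemma: nothing is known about the integrability of [U] beforehand. *)
Let rint_U4 : rint P (fun w => U w ^+ 4).
Proof.
have mU4 : measurable_fun setT (fun w => U w ^+ 4) by exact: measurable_funX.
apply/integrableP; split; first exact/measurable_EFinP.
have ra4 n : rint P (fun w => a n w ^+ 4).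
  under eq_fun do rewrite a4E -mulrA mulrC.
  apply: rintZ; apply: rintD => //; apply: rintB; first exact: rint_cst.
  exact: rintZ.
(* The factor [16 = 2^4] undoes the halving: [a] tends to [U / 2]. *)
have F := @fatou _ _ _ P setT measurableT (fun n w => (16 * a n w ^+ 4)%:E).
have cE : (\int[P]_w (16 * a n w ^+ 4)%:E)%E @[n --> \oo] --> (16 * (3 * v ^+ 2 / 16))%:E.
  rewrite [X in X @ _](_ : _ = fun n => (16 * Er P (fun w => a n w ^+ 4))%:E); last first.
    apply/funext => n; rewrite -ErZ// -expectation_Er; last exact: rintZ.
    by rewrite unlock.
  apply: cvg_EFin; first by near=> n.
  by apply: cvgM; [exact: cvg_cst|exact: cvg_Er_a4].
rewrite (cvg_limn_einf_sup cE).1 in F.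
apply: (@le_lt_trans _ _ (16 * (3 * v ^+ 2 / 16))%:E); last exact: ltry.
rewrite (eq_integral (fun w => limn_einf (fun n => (16 * a n w ^+ 4)%:E))).
  apply: F => [n|n w _]; last by rewrite lee_fin mulr_ge0// exprn_even_ge0.
  apply/measurable_EFinP.
  by apply: measurable_funM => //; exact: measurable_funX.
move=> w _.
have cw : (16 * a n w ^+ 4)%:E @[n --> \oo] --> (U w ^+ 4)%:E.
  apply: cvg_EFin; first by near=> n.
  rewrite (_ : U w ^+ 4 = 16 * (U w / 2) ^+ 4); last by field.
  apply: cvgM; first exact: cvg_cst.
  by apply: cvg_exprn; exact: cvg_a.
rewrite (cvg_limn_einf_sup cw).1 /= ger0_norm//.
by rewrite exprn_even_ge0.
Unshelve. all: by end_near. Qed.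

(** One integrable majorant, [1 + U^4], thereby serves every moment of order at most four. *)
Let norm_le14 (x : R) k : (k <= 4)%N -> `|x| ^+ k <= 1 + x ^+ 4.
Proof.
move=> k4; have -> : x ^+ 4 = `|x| ^+ 4.
  by rewrite -normrX ger0_norm// exprn_even_ge0.
have [x1|/ltW x1] := leP `|x| 1.
  by rewrite (@le_trans _ _ 1)// ?exprn_ile1// lerDl exprn_ge0.
by rewrite (le_trans (ler_weXn2l _ k4))// lerDr.
Qed.

Let rint_dom : rint P (fun w => 1 + U w ^+ 4).
Proof. by apply: rintD => //; exact: rint_cst. Qed.

Lemma cf_rint k : (k <= 4)%N -> rint P (fun w => U w ^+ k).
Proof.
move=> k4; apply: (@rint_le _ _ _ _ _ (fun w => 1 + U w ^+ 4)) => //.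
  exact: measurable_funX.
by move=> w; rewrite normrX; exact: norm_le14.
Qed.

Let Er_lim (X : nat -> Om -> R) (Y : Om -> R) (e : nat -> R) (l : R) (k : nat) : (k <= 4)%N ->
  (forall n, measurable_fun setT (X n)) -> measurable_fun setT Y ->
  (forall n w, `|X n w| <= `|U w| ^+ k) ->
  (forall w, X n w @[n --> \oo] --> Y w) ->
  (forall n, Er P (X n) = e n) -> e n @[n --> \oo] --> l -> Er P Y = l.
Proof.
move=> k4 mX mY XU cX Xe el.
have c : e n @[n --> \oo] --> Er P Y.
  under eq_fun do rewrite -Xe.
  apply: (@Er_dominated _ _ _ _ _ _ (fun w => 1 + U w ^+ 4)) => //.
  by move=> n w; rewrite (le_trans (XU n w))// norm_le14.
exact: (cvg_unique (@norm_hausdorff _ _) c el).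
Qed.

Lemma cf_moment1 : Er P U = 0.
Proof.
apply: (@Er_lim b U (fun=> 0) _ 1) => //; last exact: cvg_cst.
move=> n; rewrite /b; under [X in Er P X]eq_fun do rewrite mulrC.
by rewrite ErZ// sinU mulr0.
Qed.

Lemma cf_moment2 : Er P (fun w => U w ^+ 2) = v.
Proof.
have : Er P (fun w => (U w / 2) ^+ 2) = v / 2 / 2.
  apply: (@Er_lim (fun n w => a n w ^+ 2) _ (fun n => (1 - q n) / harmonic n ^+ 2 / 2) _ 2) => //.
  - by move=> n; exact: measurable_funX.
  - by apply: measurable_funX; exact: measurable_funM.
  - by move=> n w; rewrite normrX lerXn2r ?nnegrE.
  - by move=> w; apply: cvg_exprn; exact: cvg_a.
  - by apply: cvgM => //; exact: cvg_cst.
under [X in Er P X]eq_fun do rewrite expr_div_n mulrC.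
rewrite ErZ => [h|]; last exact: cf_rint.
apply: (@mulfI _ (2 ^- 2)); first by rewrite invr_eq0 expf_eq0 pnatr_eq0.
by rewrite h; field.
Qed.

Lemma cf_moment3 : Er P (fun w => U w ^+ 3) = 0.
Proof.
have : Er P (fun w => U w * (U w / 2) ^+ 2) = 0.
  apply: (@Er_lim (fun n w => b n w * a n w ^+ 2) _ (fun=> 0) _ 3) => //.
  - by move=> n; apply: measurable_funM => //; exact: measurable_funX.
  - apply: measurable_funM => //.
    by apply: measurable_funX; exact: measurable_funM.
  - move=> n w; rewrite normrM normrX [leRHS]exprS ler_pM// lerXn2r ?nnegrE//.
  - move=> w; apply: cvgM; first exact: cvg_b.
    by apply: cvg_exprn; exact: cvg_a.
  - exact: cvg_cst.
under [X in Er P X]eq_fun do rewrite expr_div_n mulrA -exprS mulrC.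
rewrite ErZ; last exact: cf_rint.
by move=> /eqP; rewrite mulf_eq0 invr_eq0 expf_eq0 pnatr_eq0 => /eqP.
Qed.

Lemma cf_moment4 : Er P (fun w => U w ^+ 4) = 3 * v ^+ 2.
Proof.
have : Er P (fun w => (U w / 2) ^+ 4) = 3 * v ^+ 2 / 16.
  apply: (@Er_lim (fun n w => a n w ^+ 4) _ (fun n => Er P (fun w => a n w ^+ 4)) _ 4) => //.
  - by move=> n; exact: measurable_funX.
  - by apply: measurable_funX; exact: measurable_funM.
  - by move=> n w; rewrite normrX lerXn2r ?nnegrE.
  - by move=> w; apply: cvg_exprn; exact: cvg_a.
under [X in Er P X]eq_fun do rewrite expr_div_n mulrC.
rewrite ErZ => [h|]; last exact: cf_rint.
apply: (@mulfI _ (2 ^- 4)); first by rewrite invr_eq0 expf_eq0 pnatr_eq0.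
by rewrite h; field.
Qed.

End MomentsFromCharacteristicFunction.

(** * Wick's formula *)

Section RealWick.
Context {R : realType} {d : measure_display} {Om : measurableType d}.
Variable P : probability Om R.
(** Gaussianity is reduced to rules about a single function, vanishing third moment and kurtosis 3.
    Since [H] is closed under linear combinations, these rules determine all mixed moments of order
    three and four by polarization. *)
Variable H : set (Om -> R).
Hypothesis HD : forall U V, H U -> H V -> H (fun w => U w + V w).
Hypothesis HZ : forall a U, H U -> H (fun w => a * U w).
Hypothesis Hint : forall U k, H U -> (k <= 4)%N -> rint P (fun w => U w ^+ k).
Hypothesis H3 : forall U, H U -> Er P (fun w => U w ^+ 3) = 0.
Hypothesis H4 : forall U, H U ->
  Er P (fun w => U w ^+ 4) = 3 * Er P (fun w => U w ^+ 2) ^+ 2.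

Local Notation B U V := (Er P (fun w => U w * V w)).

Lemma rint_mul2 U V : H U -> H V -> rint P (fun w => U w * V w).
Proof.
move=> HU HV.
have -> : (fun w => U w * V w) =
    (fun w => 4^-1 * ((U w + V w) ^+ 2 - (U w + -1 * V w) ^+ 2)).
  by apply/funext => w; field.
by apply: rintZ; apply: rintB; apply: (@Hint _ 2) => //; apply: HD => //; exact: HZ.
Qed.

Section Three.
Variables U V W : Om -> R.
Hypotheses (HU : H U) (HV : H V) (HW : H W).

Let L a b w := U w + a * V w + b * W w.

Let HL a b : H (L a b).
Proof. by apply: HD; [apply: HD|]; try exact: HZ. Qed.

(** The signed sum keeps only monomials odd in both [V] and [W], hence only [U V W]; it has
    coefficient [3! = 6] in each of the four cubes, whence 24. *)
Let polarization : (fun w => U w * V w * W w) =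
  (fun w => 24^-1 * (L 1 1 w ^+ 3 - L 1 (-1) w ^+ 3 - L (-1) 1 w ^+ 3 + L (-1) (-1) w ^+ 3)).
Proof. by apply/funext => w; rewrite /L; field. Qed.

Let rL a b : rint P (fun w => L a b w ^+ 3).
Proof. exact: (@Hint (L a b) 3). Qed.

Lemma rint_mul3 : rint P (fun w => U w * V w * W w).
Proof. by rewrite polarization; apply: rintZ; do !apply: rintD => //; apply: rintN. Qed.

Lemma Er_mul3 : Er P (fun w => U w * V w * W w) = 0.
Proof.
rewrite polarization ErZ; last by do !apply: rintD => //; apply: rintN.
rewrite ErD//; last by do !apply: rintD => //; apply: rintN.
rewrite ErB//; last by do !apply: rintD => //; apply: rintN.
by rewrite ErB// !H3//; field.
Qed.

End Three.

Section Four.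
Variables U V W X : Om -> R.
Hypotheses (HU : H U) (HV : H V) (HW : H W) (HX : H X).

Let L a b c w := U w + a * V w + b * W w + c * X w.

Let HL a b c : H (L a b c).
Proof. by apply: HD; [apply: HD; [apply: HD|]|]; try exact: HZ. Qed.

(** Same mechanism with three signs: coefficient [4! = 24] in each of eight fourth powers, whence
    192. *)
Let polarization : (fun w => U w * V w * W w * X w) =
  (fun w => 192^-1 * (L 1 1 1 w ^+ 4 - L 1 1 (-1) w ^+ 4 - L 1 (-1) 1 w ^+ 4
     + L 1 (-1) (-1) w ^+ 4 - L (-1) 1 1 w ^+ 4 + L (-1) 1 (-1) w ^+ 4
     + L (-1) (-1) 1 w ^+ 4 - L (-1) (-1) (-1) w ^+ 4)).
Proof. by apply/funext => w; rewrite /L; field. Qed.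

Let rL a b c : rint P (fun w => L a b c w ^+ 4).
Proof. exact: (@Hint (L a b c) 4). Qed.

Lemma rint_mul4 : rint P (fun w => U w * V w * W w * X w).
Proof. by rewrite polarization; apply: rintZ; repeat first [done|apply: rintD|apply: rintN]. Qed.

Let Er_L2 a b c : Er P (fun w => L a b c w ^+ 2) =
  B U U + a ^+ 2 * B V V + b ^+ 2 * B W W + c ^+ 2 * B X X
  + 2 * a * B U V + 2 * b * B U W + 2 * c * B U X
  + 2 * a * b * B V W + 2 * a * c * B V X + 2 * b * c * B W X.
Proof.
rewrite (_ : (fun w => L a b c w ^+ 2) = (fun w =>
  U w * U w + a ^+ 2 * (V w * V w) + b ^+ 2 * (W w * W w) + c ^+ 2 * (X w * X w)
  + (2 * a) * (U w * V w) + (2 * b) * (U w * W w) + (2 * c) * (U w * X w)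
  + (2 * a * b) * (V w * W w) + (2 * a * c) * (V w * X w) + (2 * b * c) * (W w * X w))).
  do !(rewrite ErD; [|
     by repeat first [by exact: rint_mul2|apply: rintD|apply: rintZ]
    |by repeat first [by exact: rint_mul2|apply: rintD|apply: rintZ]]).
  by rewrite !ErZ; try exact: rint_mul2.
by apply/funext => w; rewrite /L; ring.
Qed.

(** In [3 (E L^2)^2] the signed sum keeps only terms odd in each of [a], [b], [c]. These are the
    products of the cross terms in [a] and [b c], in [b] and [a c], in [c] and [a b]: the three
    pairings. *)
Lemma Er_mul4 : Er P (fun w => U w * V w * W w * X w) =
  B U V * B W X + B U W * B V X + B U X * B V W.
Proof.
rewrite polarization ErZ; last by repeat first [done|apply: rintD|apply: rintN].
do !(first [rewrite ErB|rewrite ErD]; [|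
     by repeat first [done|apply: rintD|apply: rintN]
    |by repeat first [done|apply: rintD|apply: rintN]]).
by rewrite !(H4 (HL _ _ _)) !Er_L2; field.
Qed.

End Four.
End RealWick.

(* [^*] is [Num.conj] inside the arguments of ring operations; [%C] selects the
   convertible [conjc] everywhere. *)
Section ComplexParts.
Variable R : rcfType.
Local Notation C := R[i].
Implicit Types x y z : C.

Lemma complex_ext x y :
  complex.Re x = complex.Re y -> complex.Im x = complex.Im y -> x = y.
Proof. by case: x y => [a b] [c d] /= -> ->. Qed.

Lemma Re_add x y : complex.Re (x + y) = complex.Re x + complex.Re y.
Proof. by case: x y => [a b] [c d]. Qed.

Lemma Im_add x y : complex.Im (x + y) = complex.Im x + complex.Im y.
Proof. by case: x y => [a b] [c d]. Qed.

Lemma Re_mul x y :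
  complex.Re (x * y) = complex.Re x * complex.Re y - complex.Im x * complex.Im y.
Proof. by case: x y => [a b] [c d]. Qed.

Lemma Im_mul x y :
  complex.Im (x * y) = complex.Re x * complex.Im y + complex.Im x * complex.Re y.
Proof. by case: x y => [a b] [c d]. Qed.

Lemma Re_conj z : complex.Re z^*%C = complex.Re z.
Proof. by case: z. Qed.

Lemma Im_conj z : complex.Im z^*%C = - complex.Im z.
Proof. by case: z. Qed.

Lemma conj_add x y : conjc (x + y) = conjc x + conjc y.
Proof. by case: x y => [a b] [c d]; rewrite /= opprD. Qed.

Lemma conj_mul x y : conjc (x * y) = conjc x * conjc y.
Proof. by case: x y => [a b] [c d]; apply: complex_ext => /=; ring. Qed.

Lemma conj_zero : conjc (0 : C) = 0.
Proof. by apply: complex_ext; rewrite //= oppr0. Qed.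

Lemma conj_real (a : R) : conjc a%:C = a%:C :> C.
Proof. by apply: complex_ext; rewrite //= oppr0. Qed.

Lemma conj_sum (I : Type) (r : seq I) (Q : pred I) (f : I -> C) :
  conjc (\sum_(i <- r | Q i) f i) = \sum_(i <- r | Q i) conjc (f i).
Proof. exact: (big_morph _ conj_add conj_zero). Qed.

Lemma conj_mul_conj x y : (x^*%C * y)^*%C = x * y^*%C.
Proof. by case: x y => [a b] [c d]; apply: complex_ext => /=; ring. Qed.

Lemma sqmodE z : (sqmod z)%:C = z * z^*%C.
Proof.
case: z => a b; apply: complex_ext; rewrite /sqmod /=; ring.
Qed.

End ComplexParts.

(** * Integrability and expectation of complex random variables *)

Section ComplexExpectation.
Context {R : realType} {d : measure_display} {Om : measurableType d}.
Variable P : probability Om R.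
Local Notation C := R[i].
Implicit Types X Y : Om -> C.

Definition cint X : Prop :=
  rint P (fun w => complex.Re (X w)) /\ rint P (fun w => complex.Im (X w)).

Lemma cintD X Y : cint X -> cint Y -> cint (fun w => X w + Y w).
Proof.
move=> [X1 X2] [Y1 Y2]; split.
  by under eq_fun do rewrite Re_add; exact: rintD.
by under eq_fun do rewrite Im_add; exact: rintD.
Qed.

Lemma cintZ (c : C) X : cint X -> cint (fun w => c * X w).
Proof.
move=> [X1 X2]; split.
  by under eq_fun do rewrite Re_mul; apply: rintB; exact: rintZ.
by under eq_fun do rewrite Im_mul; apply: rintD; exact: rintZ.
Qed.

Lemma cint_cst (c : C) : cint (fun=> c).
Proof. by split; exact: rint_cst. Qed.

Lemma cint_sum (I : Type) (r : seq I) (X : I -> Om -> C) :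
  (forall i, cint (X i)) -> cint (fun w => \sum_(i <- r) X i w).
Proof.
move=> iX; elim: r => [|i r IH].
  by under eq_fun do rewrite big_nil; exact: cint_cst.
by under eq_fun do rewrite big_cons; exact: cintD.
Qed.

Lemma EcD X Y : cint X -> cint Y -> Ec P (fun w => X w + Y w) = Ec P X + Ec P Y.
Proof.
move=> [X1 X2] [Y1 Y2]; apply: complex_ext; rewrite /=.
  by under [X in Er P X]eq_fun do rewrite Re_add; rewrite ErD.
by under [X in Er P X]eq_fun do rewrite Im_add; rewrite ErD.
Qed.

Lemma EcZ (c : C) X : cint X -> Ec P (fun w => c * X w) = c * Ec P X.
Proof.
move=> [X1 X2]; apply: complex_ext; rewrite ?Re_mul ?Im_mul /=.
  under [X in Er P X]eq_fun do rewrite Re_mul.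
  by rewrite ErB ?ErZ//; exact: rintZ.
under [X in Er P X]eq_fun do rewrite Im_mul.
by rewrite ErD ?ErZ//; exact: rintZ.
Qed.

Lemma Ec_cst (c : C) : Ec P (fun=> c) = c.
Proof. by apply: complex_ext; rewrite /= Er_cst. Qed.

Lemma Ec_sum (I : Type) (r : seq I) (X : I -> Om -> C) :
  (forall i, cint (X i)) ->
  Ec P (fun w => \sum_(i <- r) X i w) = \sum_(i <- r) Ec P (X i).
Proof.
move=> iX; elim: r => [|i r IH].
  by under [X in Ec P X]eq_fun do rewrite big_nil; rewrite big_nil Ec_cst.
under [X in Ec P X]eq_fun do rewrite big_cons.
by rewrite EcD// ?IH ?big_cons//; exact: cint_sum.
Qed.

Lemma Ec_real (X : Om -> R) : Ec P (fun w => (X w)%:C) = (Er P X)%:C.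
Proof. by apply: complex_ext => //=; rewrite Er_cst. Qed.

Lemma Ec_conj X : cint X -> Ec P (fun w => (X w)^*%C) = (Ec P X)^*%C.
Proof.
move=> [X1 X2]; apply: complex_ext; rewrite ?Re_conj ?Im_conj /=.
  by under [X in Er P X]eq_fun do rewrite Re_conj.
by under [X in Er P X]eq_fun do rewrite Im_conj; rewrite ErN.
Qed.

End ComplexExpectation.

(** * Circularly symmetric Gaussian spaces *)

Section GaussianSpace.
Context {R : realType} {d : measure_display} {Om : measurableType d}.
Variable P : probability Om R.
Local Notation C := R[i].

(** Circularity lies in the dependence on [c] through [sqmod c] alone. With [v = E|Y|^2], the
    variance of [Re (c Y)] is [sqmod c * v / 2], which explains the division by 4. *)
Definition circular_gaussian (Y : Om -> C) : Prop :=
  (measurable_fun setT (fun w => complex.Re (Y w)) /\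
   measurable_fun setT (fun w => complex.Im (Y w))) /\
  exists v : R, forall c : C,
    Er P (fun w => cos (complex.Re (c * Y w))) = expR (- (sqmod c * v) / 4) /\
    Er P (fun w => sin (complex.Re (c * Y w))) = 0.

(** Joint circular Gaussianity in the Cramer-Wold manner: every complex combination of members is
    again a member, so conditions on single variables control joint laws. *)
Record gaussian_space (G : set (Om -> C)) : Prop := GaussianSpace {
  gaussian_add : forall X Y, G X -> G Y -> G (fun w => X w + Y w);
  gaussian_scale : forall c X, G X -> G (fun w => c * X w);
  gaussian_circular : forall X, G X -> circular_gaussian X }.

Variable G : set (Om -> C).
Hypothesis GG : gaussian_space G.
Implicit Types X Y Z : Om -> C.
Implicit Types U V : Om -> R.

(** Imaginary parts are included: [Im X = Re (- i X)], and [G] is stable under complex scaling. This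
    is the real space fed to the real Wick formula. *)
Definition real_forms : set (Om -> R) :=
  fun U => exists2 Y, G Y & U = (fun w => complex.Re (Y w)).

Lemma real_formsD U V : real_forms U -> real_forms V -> real_forms (fun w => U w + V w).
Proof.
move=> [X GX ->] [Y GY ->]; exists (fun w => X w + Y w).
  exact: (gaussian_add GG).
by apply/funext => w; rewrite Re_add.
Qed.

Lemma real_formsZ a U : real_forms U -> real_forms (fun w => a * U w).
Proof.
move=> [X GX ->]; exists (fun w => a%:C * X w).
  exact: (gaussian_scale GG).
by apply/funext => w; rewrite Re_mul /= mul0r subr0.
Qed.

Lemma gaussian_cf Y : G Y -> exists v : R, forall c : C,
  [/\ measurable_fun setT (fun w => complex.Re (c * Y w)),
   forall s : R, Er P (fun w => cos (s * complex.Re (c * Y w))) =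
     expR (- (s ^+ 2 * (sqmod c * v / 2)) / 2) &
   forall s : R, Er P (fun w => sin (s * complex.Re (c * Y w))) = 0].
Proof.
move=> GY; have [[m1 m2] [v hv]] := gaussian_circular GG GY.
exists v => c; split.
- under eq_fun do rewrite Re_mul.
  by apply: measurable_funB; exact: measurable_funM.
- move=> s; have [h _] := hv (s%:C * c).
  rewrite (_ : (fun w => _) = fun w => cos (complex.Re (s%:C * c * Y w))).
    by rewrite h; congr expR; rewrite /sqmod Re_mul Im_mul /=; field.
  by apply/funext => w; rewrite -mulrA [in RHS]Re_mul /= mul0r subr0.
- move=> s; have [_ h] := hv (s%:C * c).
  rewrite -[RHS]h; congr (Er P _).
  by apply/funext => w; rewrite -mulrA [in RHS]Re_mul /= mul0r subr0.
Qed.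

Lemma real_forms_cf U : real_forms U ->
  exists v : R, [/\ measurable_fun setT U,
   forall s : R, Er P (fun w => cos (s * U w)) = expR (- (s ^+ 2 * v) / 2) &
   forall s : R, Er P (fun w => sin (s * U w)) = 0].
Proof.
move=> [Y GY ->]; have [v /(_ 1) hv] := gaussian_cf GY.
exists (sqmod (1 : C) * v / 2).
have -> : Y = fun w => 1 * Y w by apply/funext => w; rewrite mul1r.
exact: hv.
Qed.

Lemma real_forms_int U k : real_forms U -> (k <= 4)%N -> rint P (fun w => U w ^+ k).
Proof. by move=> /real_forms_cf[v [mU cU _]]; exact: cf_rint. Qed.

Lemma real_forms1 U : real_forms U -> Er P U = 0.
Proof. by move=> /real_forms_cf[v [mU cU sU]]; exact: cf_moment1. Qed.

Lemma real_forms3 U : real_forms U -> Er P (fun w => U w ^+ 3) = 0.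
Proof. by move=> /real_forms_cf[v [mU cU sU]]; exact: cf_moment3. Qed.

Lemma real_forms4 U : real_forms U ->
  Er P (fun w => U w ^+ 4) = 3 * Er P (fun w => U w ^+ 2) ^+ 2.
Proof.
move=> /real_forms_cf[v [mU cU sU]].
by rewrite (cf_moment4 mU cU) (cf_moment2 mU cU).
Qed.

(** [G] is in general not stable under conjugation, whereas both [X] and its conjugate have parts in
    [real_forms]; this larger class is the one needed for [E^H H]. *)
Definition complex_forms X : Prop :=
  real_forms (fun w => complex.Re (X w)) /\ real_forms (fun w => complex.Im (X w)).

Lemma gaussian_form X : G X -> complex_forms X.
Proof.
move=> GX; split; first by exists X.
exists (fun w => - 'i * X w); first exact: (gaussian_scale GG).
apply/funext => w; rewrite Re_mul.
by case: (X w) => a b /=; ring.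
Qed.

Lemma gaussian_conj_form X : G X -> complex_forms (fun w => (X w)^*%C).
Proof.
move=> /gaussian_form[X1 X2]; split.
  by under eq_fun do rewrite Re_conj.
under eq_fun do rewrite Im_conj -mulN1r.
exact: real_formsZ.
Qed.

Section Products.
Variables X1 X2 X3 X4 : Om -> C.
Hypotheses (F1 : complex_forms X1) (F2 : complex_forms X2)
  (F3 : complex_forms X3) (F4 : complex_forms X4).

Lemma cint_form : cint P X1.
Proof.
have [h1 h2] := F1; split.
  exact: (real_forms_int (k := 1) h1).
exact: (real_forms_int (k := 1) h2).
Qed.

Lemma Ec_form : Ec P X1 = 0.
Proof. by have [h1 h2] := F1; apply: complex_ext; exact: real_forms1. Qed.

Let r2 := @rint_mul2 _ _ _ P _ real_formsD real_formsZ real_forms_int.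
Let r3 := @rint_mul3 _ _ _ P _ real_formsD real_formsZ real_forms_int.
Let r4 := @rint_mul4 _ _ _ P _ real_formsD real_formsZ real_forms_int.
Let e3 := @Er_mul3 _ _ _ P _ real_formsD real_formsZ real_forms_int real_forms3.
Let e4 := @Er_mul4 _ _ _ P _ real_formsD real_formsZ real_forms_int real_forms4.

Lemma cint_form2 : cint P (fun w => X1 w * X2 w).
Proof.
have [a1 b1] := F1; have [a2 b2] := F2; split.
  by under eq_fun do rewrite Re_mul; apply: rintB; exact: r2.
by under eq_fun do rewrite Im_mul; apply: rintD; exact: r2.
Qed.

Let Re_prod3 : (fun w => complex.Re (X1 w * X2 w * X3 w)) = (fun w =>
    complex.Re (X1 w) * complex.Re (X2 w) * complex.Re (X3 w)
    - complex.Im (X1 w) * complex.Im (X2 w) * complex.Re (X3 w)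
    - complex.Re (X1 w) * complex.Im (X2 w) * complex.Im (X3 w)
    - complex.Im (X1 w) * complex.Re (X2 w) * complex.Im (X3 w)).
Proof. by apply/funext => w; rewrite !(Re_mul, Im_mul); ring. Qed.

Let Im_prod3 : (fun w => complex.Im (X1 w * X2 w * X3 w)) = (fun w =>
    complex.Re (X1 w) * complex.Re (X2 w) * complex.Im (X3 w)
    + complex.Re (X1 w) * complex.Im (X2 w) * complex.Re (X3 w)
    + complex.Im (X1 w) * complex.Re (X2 w) * complex.Re (X3 w)
    - complex.Im (X1 w) * complex.Im (X2 w) * complex.Im (X3 w)).
Proof. by apply/funext => w; rewrite !(Re_mul, Im_mul); ring. Qed.

Lemma cint_form3 : cint P (fun w => X1 w * X2 w * X3 w).
Proof.
have [a1 b1] := F1; have [a2 b2] := F2; have [a3 b3] := F3.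
by split; rewrite ?Re_prod3 ?Im_prod3;
  repeat first [by exact: r3|apply: rintD|apply: rintN].
Qed.

Lemma Ec_form3 : Ec P (fun w => X1 w * X2 w * X3 w) = 0.
Proof.
have [a1 b1] := F1; have [a2 b2] := F2; have [a3 b3] := F3.
apply: complex_ext; rewrite /= ?Re_prod3 ?Im_prod3;
do !(first [rewrite ErB|rewrite ErD]; [|
     by repeat first [by exact: r3|apply: rintD|apply: rintN]
    |by repeat first [by exact: r3|apply: rintD|apply: rintN]]);
by rewrite !e3// ?(subr0, addr0).
Qed.

Let Re_prod4 : (fun w => complex.Re (X1 w * X2 w * X3 w * X4 w)) = (fun w =>
    complex.Re (X1 w) * complex.Re (X2 w) * complex.Re (X3 w) * complex.Re (X4 w)
    + complex.Im (X1 w) * complex.Im (X2 w) * complex.Im (X3 w) * complex.Im (X4 w)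
    - complex.Im (X1 w) * complex.Im (X2 w) * complex.Re (X3 w) * complex.Re (X4 w)
    - complex.Re (X1 w) * complex.Im (X2 w) * complex.Im (X3 w) * complex.Re (X4 w)
    - complex.Im (X1 w) * complex.Re (X2 w) * complex.Im (X3 w) * complex.Re (X4 w)
    - complex.Re (X1 w) * complex.Re (X2 w) * complex.Im (X3 w) * complex.Im (X4 w)
    - complex.Re (X1 w) * complex.Im (X2 w) * complex.Re (X3 w) * complex.Im (X4 w)
    - complex.Im (X1 w) * complex.Re (X2 w) * complex.Re (X3 w) * complex.Im (X4 w)).
Proof. by apply/funext => w; rewrite !(Re_mul, Im_mul); ring. Qed.

Let Im_prod4 : (fun w => complex.Im (X1 w * X2 w * X3 w * X4 w)) = (fun w =>
    complex.Re (X1 w) * complex.Re (X2 w) * complex.Re (X3 w) * complex.Im (X4 w)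
    + complex.Re (X1 w) * complex.Re (X2 w) * complex.Im (X3 w) * complex.Re (X4 w)
    + complex.Re (X1 w) * complex.Im (X2 w) * complex.Re (X3 w) * complex.Re (X4 w)
    + complex.Im (X1 w) * complex.Re (X2 w) * complex.Re (X3 w) * complex.Re (X4 w)
    - complex.Im (X1 w) * complex.Im (X2 w) * complex.Re (X3 w) * complex.Im (X4 w)
    - complex.Re (X1 w) * complex.Im (X2 w) * complex.Im (X3 w) * complex.Im (X4 w)
    - complex.Im (X1 w) * complex.Re (X2 w) * complex.Im (X3 w) * complex.Im (X4 w)
    - complex.Im (X1 w) * complex.Im (X2 w) * complex.Im (X3 w) * complex.Re (X4 w)).
Proof. by apply/funext => w; rewrite !(Re_mul, Im_mul); ring. Qed.

Lemma cint_form4 : cint P (fun w => X1 w * X2 w * X3 w * X4 w).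
Proof.
have [a1 b1] := F1; have [a2 b2] := F2; have [a3 b3] := F3; have [a4 b4] := F4.
by split; rewrite ?Re_prod4 ?Im_prod4;
  repeat first [by exact: r4|apply: rintD|apply: rintN].
Qed.

End Products.

Lemma Ec_form2 X Y : complex_forms X -> complex_forms Y ->
  Ec P (fun w => X w * Y w) =
  (Er P (fun w => complex.Re (X w) * complex.Re (Y w))
   - Er P (fun w => complex.Im (X w) * complex.Im (Y w))) +i*
  (Er P (fun w => complex.Re (X w) * complex.Im (Y w))
   + Er P (fun w => complex.Im (X w) * complex.Re (Y w))).
Proof.
have r2 := @rint_mul2 _ _ _ P _ real_formsD real_formsZ real_forms_int.
move=> [a1 b1] [a2 b2]; apply: complex_ext => /=.
  by under [X in Er P X]eq_fun do rewrite Re_mul; rewrite ErB//; exact: r2.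
by under [X in Er P X]eq_fun do rewrite Im_mul; rewrite ErD//; exact: r2.
Qed.

(** Both sides are multilinear, so the identity reduces to sixteen real instances, eight for each
    part. All three pairings appear here; circularity is applied only afterwards. *)
Lemma Ec_form4 X1 X2 X3 X4 : complex_forms X1 -> complex_forms X2 ->
  complex_forms X3 -> complex_forms X4 ->
  Ec P (fun w => X1 w * X2 w * X3 w * X4 w) =
    Ec P (fun w => X1 w * X2 w) * Ec P (fun w => X3 w * X4 w) +
    Ec P (fun w => X1 w * X3 w) * Ec P (fun w => X2 w * X4 w) +
    Ec P (fun w => X1 w * X4 w) * Ec P (fun w => X2 w * X3 w).
Proof.
move=> F1 F2 F3 F4.
rewrite (Ec_form2 F1 F2) (Ec_form2 F1 F3) (Ec_form2 F1 F4).
rewrite (Ec_form2 F2 F3) (Ec_form2 F2 F4) (Ec_form2 F3 F4).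
have [a1 b1] := F1; have [a2 b2] := F2; have [a3 b3] := F3; have [a4 b4] := F4.
have r4 := @rint_mul4 _ _ _ P _ real_formsD real_formsZ real_forms_int.
have e4 := @Er_mul4 _ _ _ P _ real_formsD real_formsZ real_forms_int real_forms4.
apply: complex_ext; rewrite !(Re_add, Im_add, Re_mul, Im_mul) /=.
  rewrite (_ : (fun w => complex.Re (X1 w * X2 w * X3 w * X4 w)) = (fun w =>
    complex.Re (X1 w) * complex.Re (X2 w) * complex.Re (X3 w) * complex.Re (X4 w)
    + complex.Im (X1 w) * complex.Im (X2 w) * complex.Im (X3 w) * complex.Im (X4 w)
    - complex.Im (X1 w) * complex.Im (X2 w) * complex.Re (X3 w) * complex.Re (X4 w)
    - complex.Re (X1 w) * complex.Im (X2 w) * complex.Im (X3 w) * complex.Re (X4 w)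
    - complex.Im (X1 w) * complex.Re (X2 w) * complex.Im (X3 w) * complex.Re (X4 w)
    - complex.Re (X1 w) * complex.Re (X2 w) * complex.Im (X3 w) * complex.Im (X4 w)
    - complex.Re (X1 w) * complex.Im (X2 w) * complex.Re (X3 w) * complex.Im (X4 w)
    - complex.Im (X1 w) * complex.Re (X2 w) * complex.Re (X3 w) * complex.Im (X4 w))); last first.
    by apply/funext => w; rewrite !(Re_mul, Im_mul); ring.
  do !(first [rewrite ErB|rewrite ErD]; [|
     by repeat first [by exact: r4|apply: rintD|apply: rintN]
    |by repeat first [by exact: r4|apply: rintD|apply: rintN]]).
  by rewrite !e4//; ring.
rewrite (_ : (fun w => complex.Im (X1 w * X2 w * X3 w * X4 w)) = (fun w =>
    complex.Re (X1 w) * complex.Re (X2 w) * complex.Re (X3 w) * complex.Im (X4 w)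
    + complex.Re (X1 w) * complex.Re (X2 w) * complex.Im (X3 w) * complex.Re (X4 w)
    + complex.Re (X1 w) * complex.Im (X2 w) * complex.Re (X3 w) * complex.Re (X4 w)
    + complex.Im (X1 w) * complex.Re (X2 w) * complex.Re (X3 w) * complex.Re (X4 w)
    - complex.Im (X1 w) * complex.Im (X2 w) * complex.Re (X3 w) * complex.Im (X4 w)
    - complex.Re (X1 w) * complex.Im (X2 w) * complex.Im (X3 w) * complex.Im (X4 w)
    - complex.Im (X1 w) * complex.Re (X2 w) * complex.Im (X3 w) * complex.Im (X4 w)
    - complex.Im (X1 w) * complex.Im (X2 w) * complex.Im (X3 w) * complex.Re (X4 w))); last first.
  by apply/funext => w; rewrite !(Re_mul, Im_mul); ring.
do !(first [rewrite ErB|rewrite ErD]; [|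
     by repeat first [by exact: r4|apply: rintD|apply: rintN]
    |by repeat first [by exact: r4|apply: rintD|apply: rintN]]).
by rewrite !e4//; ring.
Qed.

End GaussianSpace.

(** * Moments of shifted products and of matched-filter outputs *)

Section GaussianMoments.
Context {R : realType} {d : measure_display} {Om : measurableType d}.
Variable P : probability Om R.
Local Notation C := R[i].
Variable G : set (Om -> C).
Hypothesis GG : gaussian_space P G.
Implicit Types X Y Z E H : Om -> C.

Let form X (GX : G X) : complex_forms G X := gaussian_form GG GX.
Let formc X (GX : G X) : complex_forms G (fun w => (X w)^*%C) := gaussian_conj_form GG GX.

(** The directions [1], [-i] and [1 - i] isolate [Re Y], [Im Y] and their sum. The first two have
    variance [v / 2] and the sum has variance [v], so the parts are uncorrelated. *)
Lemma gaussian_second_moments Y (v : R) : G Y ->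
  (forall c : C, Er P (fun w => cos (complex.Re (c * Y w))) = expR (- (sqmod c * v) / 4)) ->
  Ec P (fun w => Y w * Y w) = 0 /\ Ec P (fun w => Y w * (Y w)^*%C) = v%:C.
Proof.
move=> GY hv.
have [[mRe mIm] _] := gaussian_circular GG GY.
have m2 (c : C) : Er P (fun w => complex.Re (c * Y w) ^+ 2) = sqmod c * v / 2.
  apply: cf_moment2 => [|s].
    under eq_fun do rewrite Re_mul.
    by apply: measurable_funB; exact: measurable_funM.
  transitivity (Er P (fun w => cos (complex.Re (s%:C * c * Y w)))).
    congr (Er P _); apply/funext => w; congr cos.
    by rewrite -mulrA [in RHS]Re_mul /= mul0r subr0.
  by rewrite hv; congr expR; rewrite /sqmod Re_mul Im_mul /=; field.
have [r1 r2] := form GY.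
have rm := @rint_mul2 _ _ _ P _ (real_formsD GG) (real_formsZ GG) (real_forms_int GG).
have eRe : Er P (fun w => complex.Re (Y w) * complex.Re (Y w)) = v / 2.
  have := m2 1; rewrite /sqmod /= expr1n expr0n addr0 mul1r => <-.
  by congr (Er P _); apply/funext => w; rewrite mul1r expr2.
have eIm : Er P (fun w => complex.Im (Y w) * complex.Im (Y w)) = v / 2.
  have := m2 (0 +i* (-1)); rewrite /sqmod /= sqrrN expr1n expr0n add0r mul1r => <-.
  by congr (Er P _); apply/funext => w; rewrite Re_mul /=; ring.
have eRI : Er P (fun w => complex.Re (Y w) * complex.Im (Y w)) = 0.
  have := m2 (1 +i* (-1)); rewrite /sqmod /= sqrrN expr1n.
  rewrite (_ : (fun w => _) = (fun w => complex.Re (Y w) * complex.Re (Y w) +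
     2 * (complex.Re (Y w) * complex.Im (Y w)) + complex.Im (Y w) * complex.Im (Y w))); last first.
    by apply/funext => w; rewrite Re_mul /=; ring.
  rewrite ErD; [|by apply: rintD; [exact: rm|apply: rintZ; exact: rm]|exact: rm].
  rewrite ErD; [|exact: rm|by apply: rintZ; exact: rm].
  by rewrite ErZ ?eRe ?eIm; [lra|exact: rm].
have eIR : Er P (fun w => complex.Im (Y w) * complex.Re (Y w)) = 0.
  by rewrite -eRI; congr (Er P _); apply/funext => w; rewrite mulrC.
split.
  by rewrite (Ec_form2 GG (form GY) (form GY)) eRe eIm eRI eIR subrr addr0.
transitivity (Ec P (fun w => (sqmod (Y w))%:C)).
  by congr (Ec P _); apply/funext => w; rewrite sqmodE.
rewrite Ec_real; congr (_%:C); rewrite /sqmod.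
under [X in Er P X]eq_fun do rewrite 2!expr2.
by rewrite ErD ?eRe ?eIm; [field|exact: rm|exact: rm].
Qed.

(** The square of every member has expectation zero; apply this to [X], [Y] and [X + Y]. *)
Lemma gaussian_pseudo_covariance X Y : G X -> G Y -> Ec P (fun w => X w * Y w) = 0.
Proof.
have sq Z : G Z -> Ec P (fun w => Z w * Z w) = 0.
  move=> GZ; have [_ [v hv]] := gaussian_circular GG GZ.
  by have [] := @gaussian_second_moments Z v GZ (fun c => (hv c).1).
move=> GX GY.
have c2 A B : G A -> G B -> cint P (fun w => A w * B w).
  by move=> GA GB; exact: (cint_form2 GG (form GA) (form GB)).
have := sq _ (gaussian_add GG GX GY).
rewrite (_ : (fun w => _) = (fun w => X w * X w + (2 * (X w * Y w) + Y w * Y w))); last first.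
  by apply/funext => w; ring.
rewrite EcD; [|exact: c2|by apply: cintD; [apply: cintZ; exact: c2|exact: c2]].
rewrite EcD; [|by apply: cintZ; exact: c2|exact: c2].
rewrite EcZ ?sq//; last exact: c2.
by rewrite add0r addr0 => /eqP; rewrite mulf_eq0 pnatr_eq0 => /eqP.
Qed.

Lemma gaussian_pseudo_covariance_conj X Y : G X -> G Y ->
  Ec P (fun w => (X w)^*%C * (Y w)^*%C) = 0.
Proof.
move=> GX GY; transitivity (Ec P (fun w => (X w * Y w)^*%C)).
  by congr (Ec P _); apply/funext => w; rewrite conj_mul.
rewrite Ec_conj ?gaussian_pseudo_covariance ?conjc0//.
exact: (cint_form2 GG (form GX) (form GY)).
Qed.

(* Odd moments vanish, and circular symmetry kills the pairings [E[E' H]] and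
   [E[E^* H'^*]], so only two of the three Wick pairings survive. *)
Section ShiftedProduct.
Variables (E E' H H' : Om -> C) (c1 c2 c3 c4 : C).
Hypotheses (GE : G E) (GE' : G E') (GH : G H) (GH' : G H').

Let X1 w := (E w)^*%C.
Let X2 := H.
Let X3 := E'.
Let X4 w := (H' w)^*%C.

Let expansion : (fun w => (c1 + X1 w) * (c2 + X2 w) * ((c3 + X3 w) * (c4 + X4 w))) =
  (fun w => c1 * c2 * c3 * c4
   + ((c2 * c3 * c4) * X1 w + ((c1 * c3 * c4) * X2 w + ((c1 * c2 * c4) * X3 w
   + ((c1 * c2 * c3) * X4 w
   + ((c3 * c4) * (X1 w * X2 w) + ((c2 * c4) * (X1 w * X3 w) + ((c2 * c3) * (X1 w * X4 w)
   + ((c1 * c4) * (X2 w * X3 w) + ((c1 * c3) * (X2 w * X4 w) + ((c1 * c2) * (X3 w * X4 w)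
   + (c4 * (X1 w * X2 w * X3 w) + (c3 * (X1 w * X2 w * X4 w) + (c2 * (X1 w * X3 w * X4 w)
   + (c1 * (X2 w * X3 w * X4 w) + X1 w * X2 w * X3 w * X4 w))))))))))))))).
Proof. by apply/funext => w; ring. Qed.

Let F1 : complex_forms G X1 := formc GE.
Let F2 : complex_forms G X2 := form GH.
Let F3 : complex_forms G X3 := form GE'.
Let F4 : complex_forms G X4 := formc GH'.

Let i1 X (F : complex_forms G X) : cint P X := cint_form GG F.
Let i2 := cint_form2 GG.
Let i3 := cint_form3 GG.
Let i4 : cint P (fun w => X1 w * X2 w * X3 w * X4 w).
Proof. exact: (cint_form4 GG). Qed.

(** [m] numbers the integrability of the single summands of [expansion], [t] that of the tails
    starting there; each use of [EcD] below consumes one of each. *)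
Let m0 := cint_cst P (c1 * c2 * c3 * c4).
Let m1 := cintZ (c2 * c3 * c4) (i1 F1).
Let m2 := cintZ (c1 * c3 * c4) (i1 F2).
Let m3 := cintZ (c1 * c2 * c4) (i1 F3).
Let m4 := cintZ (c1 * c2 * c3) (i1 F4).
Let m5 := cintZ (c3 * c4) (i2 F1 F2).
Let m6 := cintZ (c2 * c4) (i2 F1 F3).
Let m7 := cintZ (c2 * c3) (i2 F1 F4).
Let m8 := cintZ (c1 * c4) (i2 F2 F3).
Let m9 := cintZ (c1 * c3) (i2 F2 F4).
Let m10 := cintZ (c1 * c2) (i2 F3 F4).
Let m11 := cintZ (c4) (i3 F1 F2 F3).
Let m12 := cintZ (c3) (i3 F1 F2 F4).
Let m13 := cintZ (c2) (i3 F1 F3 F4).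
Let m14 := cintZ (c1) (i3 F2 F3 F4).
Let t14 := cintD m14 i4.
Let t13 := cintD m13 t14.
Let t12 := cintD m12 t13.
Let t11 := cintD m11 t12.
Let t10 := cintD m10 t11.
Let t9 := cintD m9 t10.
Let t8 := cintD m8 t9.
Let t7 := cintD m7 t8.
Let t6 := cintD m6 t7.
Let t5 := cintD m5 t6.
Let t4 := cintD m4 t5.
Let t3 := cintD m3 t4.
Let t2 := cintD m2 t3.
Let t1 := cintD m1 t2.

Lemma cint_shifted_product :
  cint P (fun w => (c1 + X1 w) * (c2 + X2 w) * ((c3 + X3 w) * (c4 + X4 w))).
Proof. rewrite expansion; exact: (cintD m0 t1). Qed.

Lemma cint_shifted_product2 : cint P (fun w => (c1 + X1 w) * (c2 + X2 w)).
Proof.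
rewrite (_ : (fun w => _) =
  (fun w => c1 * c2 + (c1 * X2 w + (c2 * X1 w + X1 w * X2 w)))); last first.
  by apply/funext => w; ring.
by repeat first [by apply: i2|by apply: i1|by apply: cint_cst|apply: cintD|apply: cintZ].
Qed.

Lemma Ec_shifted_product2 : Ec P (fun w => (c1 + X1 w) * (c2 + X2 w)) =
  c1 * c2 + Ec P (fun w => X1 w * X2 w).
Proof.
rewrite (_ : (fun w => _) =
  (fun w => c1 * c2 + (c1 * X2 w + (c2 * X1 w + X1 w * X2 w)))); last first.
  by apply/funext => w; ring.
do !(rewrite EcD; [|by repeat first [by apply: i2|by apply: i1|by apply: cint_cst|apply: cintD|apply: cintZ]..]).
rewrite Ec_cst !EcZ; [|exact: i1..].
by rewrite (Ec_form GG F1) (Ec_form GG F2); ring.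
Qed.

Lemma Ec_shifted_product :
  Ec P (fun w => (c1 + X1 w) * (c2 + X2 w) * ((c3 + X3 w) * (c4 + X4 w))) =
  (c1 * c2 + Ec P (fun w => X1 w * X2 w)) * (c3 * c4 + Ec P (fun w => X3 w * X4 w))
  + c1 * c3 * Ec P (fun w => X2 w * X4 w)
  + c2 * c4 * Ec P (fun w => X1 w * X3 w)
  + Ec P (fun w => X1 w * X3 w) * Ec P (fun w => X2 w * X4 w).
Proof.
rewrite expansion (EcD m0 t1) (EcD m1 t2) (EcD m2 t3) (EcD m3 t4) (EcD m4 t5) (EcD m5 t6) (EcD m6 t7) 
  (EcD m7 t8) (EcD m8 t9) (EcD m9 t10) (EcD m10 t11) (EcD m11 t12) (EcD m12 t13) (EcD m13 t14) (EcD m14 i4).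
rewrite Ec_cst (EcZ _ (i1 F1)) (EcZ _ (i1 F2)) (EcZ _ (i1 F3)) (EcZ _ (i1 F4)) 
  (EcZ _ (i2 F1 F2)) (EcZ _ (i2 F1 F3)) (EcZ _ (i2 F1 F4)) (EcZ _ (i2 F2 F3)) (EcZ _ (i2 F2 F4)) (EcZ _ (i2 F3 F4)) 
  (EcZ _ (i3 F1 F2 F3)) (EcZ _ (i3 F1 F2 F4)) (EcZ _ (i3 F1 F3 F4)) (EcZ _ (i3 F2 F3 F4)).
rewrite (Ec_form3 GG F1 F2 F3) (Ec_form3 GG F1 F2 F4) (Ec_form3 GG F1 F3 F4)
  (Ec_form3 GG F2 F3 F4) (Ec_form GG F1) (Ec_form GG F2) (Ec_form GG F3) (Ec_form GG F4).
rewrite (Ec_form4 GG F1 F2 F3 F4).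
rewrite (gaussian_pseudo_covariance_conj GE GH') (gaussian_pseudo_covariance GH GE').
by ring.
Qed.

End ShiftedProduct.

Section MatchedFilter.
Variables (T : finType) (al be : T -> C) (E H : T -> Om -> C).
Hypotheses (GE : forall a, G (E a)) (GH : forall a, G (H a)).

Local Notation z := (fun w => \sum_a (al a + E a w)^*%C * (be a + H a w)).

Let zE : z = fun w => \sum_a ((al a)^*%C + (E a w)^*%C) * (be a + H a w).
Proof. by apply/funext => w; apply: eq_bigr => a _; rewrite conj_add. Qed.

Lemma Ec_matched_filter :
  Ec P z = \sum_a ((al a)^*%C * be a + Ec P (fun w => (E a w)^*%C * H a w)).
Proof.
rewrite zE Ec_sum; last by move=> a; exact: cint_shifted_product2.
by apply: eq_bigr => a _; rewrite Ec_shifted_product2.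
Qed.

(** In the double sum over [a] and [b], the leading term of [Ec_shifted_product] factors into a term
    in [a] times a term in [b], and so sums to [|E z|^2]. The other three terms couple [a] and [b]
    through covariances. *)
Lemma Er_sqmod_matched_filter :
  (Er P (fun w => sqmod (z w)))%:C = Ec P z * (Ec P z)^*%C
  + \sum_a \sum_b (al a)^*%C * al b * Ec P (fun w => H a w * (H b w)^*%C)
  + \sum_a \sum_b be a * (be b)^*%C * Ec P (fun w => (E a w)^*%C * E b w)
  + \sum_a \sum_b Ec P (fun w => (E a w)^*%C * E b w) * Ec P (fun w => H a w * (H b w)^*%C).
Proof.
rewrite -Ec_real.
have -> : (fun w => (sqmod (z w))%:C) = (fun w => \sum_a \sum_b
    ((al a)^*%C + (E a w)^*%C) * (be a + H a w) *
    ((al b + E b w) * ((be b)^*%C + (H b w)^*%C))).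
  apply/funext => w; rewrite sqmodE; cbv beta; rewrite conj_sum big_distrlr/=.
  apply: eq_bigr => a _; apply: eq_bigr => b _.
  by rewrite conj_mul_conj !conj_add.
have ic a b : cint P (fun w => ((al a)^*%C + (E a w)^*%C) * (be a + H a w) *
    ((al b + E b w) * ((be b)^*%C + (H b w)^*%C))) by exact: cint_shifted_product.
rewrite Ec_sum; last by move=> a; exact: cint_sum.
rewrite Ec_matched_filter conj_sum big_distrlr/=.
rewrite -!big_split/=; apply: eq_bigr => a _.
rewrite Ec_sum// -!big_split/=; apply: eq_bigr => b _.
rewrite Ec_shifted_product//; congr (_ * _ + _ + _ + _).
rewrite conj_add conj_mul_conj; congr (_ + _).
rewrite -Ec_conj.
  by congr (Ec P _); apply/funext => w; rewrite conj_mul_conj.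
exact: (cint_form2 GG (formc (GE b)) (form (GH b))).
Qed.

End MatchedFilter.
End GaussianMoments.

(** * Gaussian spaces spanned by independent Gaussian vectors *)

Section ConjugateTranspose.
Variable R : rcfType.
Local Notation C := R[i].

Lemma conj_mul_ge0 (z : C) : 0 <= conjc z * z.
Proof.
case: z => x y; rewrite lecE /=; apply/andP; split; first by apply/eqP; ring.
by rewrite mulNr opprK -!expr2 addr_ge0// sqr_ge0.
Qed.

Lemma ctrD m n (A B : 'M[C]_(m, n)) : ctr (A + B) = ctr A + ctr B.
Proof. by apply/matrixP => i j; rewrite !mxE conj_add. Qed.

Lemma ctrZ m n c (A : 'M[C]_(m, n)) : ctr (c *: A) = conjc c *: ctr A.
Proof. by apply/matrixP => i j; rewrite !mxE conj_mul. Qed.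

Lemma ctr_real_scale (s : R) m n (B : 'M[C]_(m, n)) : ctr (s%:C *: B) = s%:C *: ctr B.
Proof. by rewrite ctrZ conj_real. Qed.

Lemma ctr0 m n : ctr (0 : 'M[C]_(m, n)) = 0.
Proof. by apply/matrixP => i j; rewrite !mxE conj_zero. Qed.

Lemma ctrK m n (A : 'M[C]_(m, n)) : ctr (ctr A) = A.
Proof. by apply/matrixP => i j; rewrite !mxE conjcK. Qed.

Lemma ctrM m n p (A : 'M[C]_(m, n)) (B : 'M[C]_(n, p)) : ctr (A *m B) = ctr B *m ctr A.
Proof.
apply/matrixP => i j; rewrite !mxE conj_sum.
by apply: eq_bigr => k _; rewrite !mxE conj_mul mulrC.
Qed.

Lemma cdotE n (x y : 'cV[C]_n) : cdot x y = \sum_j conjc (x j 0) * y j 0.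
Proof. by rewrite /cdot mxE; apply: eq_bigr => j _; rewrite !mxE. Qed.

Lemma cdotDl n (x y z : 'cV[C]_n) : cdot (x + y) z = cdot x z + cdot y z.
Proof. by rewrite /cdot ctrD mulmxDl mxE. Qed.

Lemma cdotZl n c (x z : 'cV[C]_n) : cdot (c *: x) z = conjc c * cdot x z.
Proof. by rewrite /cdot ctrZ -scalemxAl mxE. Qed.

Lemma cdot0l n (z : 'cV[C]_n) : cdot 0 z = 0.
Proof. by rewrite /cdot ctr0 mul0mx mxE. Qed.

Lemma cqfDl n (x y z : 'cV[C]_n) A : cqf (x + y) A z = cqf x A z + cqf y A z.
Proof. by rewrite /cqf ctrD !mulmxDl mxE. Qed.

Lemma cqfDr n (x y z : 'cV[C]_n) A : cqf z A (x + y) = cqf z A x + cqf z A y.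
Proof. by rewrite /cqf mulmxDr mxE. Qed.

Lemma cqfZl n c (x z : 'cV[C]_n) A : cqf (c *: x) A z = conjc c * cqf x A z.
Proof. by rewrite /cqf ctrZ -!scalemxAl mxE. Qed.

Lemma cqfZr n c (x z : 'cV[C]_n) A : cqf x A (c *: z) = c * cqf x A z.
Proof. by rewrite /cqf -!scalemxAr mxE. Qed.

Lemma cqf0l n (z : 'cV[C]_n) A : cqf 0 A z = 0.
Proof. by rewrite /cqf ctr0 !mul0mx mxE. Qed.

Lemma cqf0r n (z : 'cV[C]_n) A : cqf z A 0 = 0.
Proof. by rewrite /cqf mulmx0 mxE. Qed.

Lemma ctr_delta n (j : 'I_n) : ctr (delta_mx j 0 : 'cV[C]_n) = delta_mx 0 j.
Proof.
apply/matrixP => i k; rewrite !mxE andbC.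
by case: (_ && _); rewrite ?conj_zero//; exact: (conj_real 1).
Qed.

Lemma cdot_delta n (j : 'I_n) (z : 'cV[C]_n) : cdot (delta_mx j 0) z = z j 0.
Proof. by rewrite /cdot ctr_delta -rowE mxE. Qed.

Lemma cqf_delta n (j k : 'I_n) (A : 'M[C]_n) : cqf (delta_mx j 0) A (delta_mx k 0) = A j k.
Proof. by rewrite /cqf ctr_delta -colE -rowE !mxE. Qed.

Lemma psd_im n (A : 'M[C]_n) v : psd A -> complex.Im (cqf v A v) = 0.
Proof. by move=> [_ /(_ v)]; rewrite lecE /= => /andP[/eqP]. Qed.

Lemma psd_scalar n (a : R) : 0 <= a -> psd (a%:C%:M : 'M[C]_n).
Proof.
move=> a0; split.
  apply/matrixP => i j; rewrite !mxE eq_sym; case: eqP => _; rewrite ?mulr0n ?mulr1n ?conj_zero//.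
  exact: conj_real.
move=> v; rewrite /cqf mul_mx_scalar -scalemxAl mxE mulr_ge0 ?ler0c//.
by rewrite -/(cdot v v) cdotE sumr_ge0// => j _; exact: conj_mul_ge0.
Qed.

End ConjugateTranspose.

(** For a sesquilinear form with values [a] at [(t, u)] and [b] at [(u, t)], the coefficient [1]
    yields [a + b] and the coefficient [i] yields [a - b]. *)
Lemma sesqui_polarization (R : realType) (a b a' b' : R[i]) :
  1 * a + 1 * b = 1 * a' + 1 * b' ->
  - (0 +i* 1) * a + (0 +i* 1) * b = - (0 +i* 1) * a' + (0 +i* 1) * b' -> a = a'.
Proof.
case: a b a' b' => [x y] [z u] [x' y'] [z' u'] /= [h1 h2] [h3 h4].
by congr (_ +i* _); lra.
Qed.

Section IndependentGaussianFamily.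
Local Open Scope classical_set_scope.
Local Open Scope ring_scope.
Local Open Scope complex_scope.
Context {R : realType} {d : measure_display} {Om : measurableType d}.
Variable P : probability Om R.
Local Notation C := R[i].
Variables (I : finType) (F : I -> @crv R d Om).
Variable mu : forall i, 'cV[C]_(crv_dim (F i)).
Variable S : forall i, 'M[C]_(crv_dim (F i)).
Hypothesis Spsd : forall i, psd (S i).
Hypothesis CNF : forall i, isCN P (crv_fun (F i)) (mu i) (S i).
Hypothesis indF : mutually_independent P F.

Local Notation dir := (forall i, 'cV[C]_(crv_dim (F i))).
Implicit Types t u : dir.

(** The direction enters conjugated, as in [isCN]; hence the [conjc c] wherever a form is scaled by
    [c]. *)
Definition linear_form t (w : Om) : C := \sum_i cdot (t i) (crv_fun (F i) w - mu i).

Definition linear_forms : set (Om -> C) := range linear_form.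

Definition form_variance t : R := \sum_i complex.Re (cqf (t i) (S i) (t i)).

Lemma linear_formD t u :
  linear_form (fun i => t i + u i) = fun w => linear_form t w + linear_form u w.
Proof.
apply/funext => w; rewrite /linear_form -big_split/=.
by apply: eq_bigr => i _; rewrite cdotDl.
Qed.

Lemma linear_formZ c t :
  linear_form (fun i => conjc c *: t i) = fun w => c * linear_form t w.
Proof.
apply/funext => w; rewrite /linear_form mulr_sumr.
by apply: eq_bigr => i _; rewrite cdotZl conjcK.
Qed.

Lemma Re_sum (J : Type) (r : seq J) (f : J -> C) :
  complex.Re (\sum_(j <- r) f j) = \sum_(j <- r) complex.Re (f j).
Proof. by apply: (big_morph _ (@Re_add R)). Qed.

(** Measurability on [Om] would be too weak here: the independence argument acts only on functions
    measurable for the sigma-algebra of the orthants of the block [i]. *)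
Lemma cdot_sigma_measurable i (t : 'cV[C]_(crv_dim (F i))) :
  measurable_fun setT
   ((fun w => complex.Re (cdot t (crv_fun (F i) w - mu i))) :
      g_sigma_algebraType (below_sets (F i)) -> R).
Proof.
rewrite (_ : (fun w => _) = (fun w => \sum_j
   (complex.Re (t j 0) * (complex.Re (crv_fun (F i) w j 0) - complex.Re (mu i j 0))
    + complex.Im (t j 0) * (complex.Im (crv_fun (F i) w j 0) - complex.Im (mu i j 0)))));
    last first.
  apply/funext => w; rewrite cdotE Re_sum; apply: eq_bigr => j _.
  by rewrite Re_mul !mxE; case: (t j 0) (crv_fun _ _ _ _) (mu _ _ _) => [? ?] [? ?] [? ?] /=; ring.
apply: measurable_sum => j; apply: measurable_funD; apply: measurable_funM => //;
  apply: measurable_funB => //.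
  exact: Re_coord_sigma_measurable.
exact: Im_coord_sigma_measurable.
Qed.

(** Independence enters here: the exponents of the blocks add up, so a form mixing all blocks is
    again Gaussian. *)
Lemma linear_form_cf t :
  Er P (fun w => cos (complex.Re (linear_form t w))) = expR (- form_variance t / 4) /\
  Er P (fun w => sin (complex.Re (linear_form t w))) = 0.
Proof.
have mF i : cmeas (crv_fun (F i)) by have [] := CNF i.
have hc i : Er P (fun w => cos (complex.Re (cdot (t i) (crv_fun (F i) w - mu i)))) =
    expR (- complex.Re (cqf (t i) (S i) (t i)) / 4).
  by have [_ /(_ (t i))[h _]] := CNF i; rewrite /Er h.
have hs i : Er P (fun w => sin (complex.Re (cdot (t i) (crv_fun (F i) w - mu i)))) = 0.
  by have [_ /(_ (t i))[_ h]] := CNF i; rewrite /Er h.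
have m i := @cdot_sigma_measurable i (t i).
have c := Er_cos_sum mF indF m hc hs; have s := Er_sin_sum mF indF m hc hs.
rewrite /linear_form; split.
  under [X in Er P X]eq_fun do rewrite Re_sum.
  rewrite c -expR_sum; congr expR.
  by rewrite /form_variance mulNr mulr_suml -sumrN; apply: eq_bigr => i _; rewrite mulNr.
by under [X in Er P X]eq_fun do rewrite Re_sum.
Qed.

Lemma form_varianceZ c t : form_variance (fun i => conjc c *: t i) = sqmod c * form_variance t.
Proof.
rewrite /form_variance mulr_sumr; apply: eq_bigr => i _.
rewrite cqfZl cqfZr conjcK; case: (cqf _ _ _) => x y; case: c => a b.
by rewrite /sqmod /=; ring.
Qed.

Lemma linear_form_circular t c :
  Er P (fun w => cos (complex.Re (c * linear_form t w))) =
    expR (- (sqmod c * form_variance t) / 4) /\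
  Er P (fun w => sin (complex.Re (c * linear_form t w))) = 0.
Proof.
have := linear_form_cf (fun i => conjc c *: t i).
by rewrite form_varianceZ linear_formZ.
Qed.

Lemma linear_forms_gaussian : gaussian_space P linear_forms.
Proof.
have mRe t : measurable_fun setT (fun w => complex.Re (linear_form t w)).
  rewrite /linear_form; under eq_fun do rewrite Re_sum.
  apply: measurable_sum => i.
  apply: (g_sigma_measurable_fun _ (@cdot_sigma_measurable i (t i))).
  by apply: below_sets_measurable; have [] := CNF i.
split.
- by move=> _ _ [t _ <-] [u _ <-]; exists (fun i => t i + u i) => //; rewrite linear_formD.
- by move=> c _ [t _ <-]; exists (fun i => conjc c *: t i) => //; rewrite linear_formZ.
move=> _ [t _ <-]; split.
  split; first exact: mRe.
  (* The imaginary part of a form is the real part of the form multiplied by [-i]. *)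
  have := mRe (fun i => conjc (0 +i* (-1)) *: t i); rewrite linear_formZ.
  by under eq_fun do rewrite Re_mul /= mul0r sub0r mulN1r opprK.
by exists (form_variance t) => c; exact: linear_form_circular.
Qed.

Let GG := linear_forms_gaussian.

Lemma linear_form_in t : linear_forms (linear_form t).
Proof. by exists t. Qed.

Lemma Ec_linear_form_sqr t :
  Ec P (fun w => linear_form t w * conjc (linear_form t w)) = \sum_i cqf (t i) (S i) (t i).
Proof.
have [_ ->] := gaussian_second_moments GG (linear_form_in t)
  (fun c => (linear_form_circular t c).1).
apply: complex_ext; first by rewrite Re_sum.
rewrite (big_morph _ (@Im_add R) (erefl : complex.Im (0 : C) = 0)) big1// => i _.
exact: psd_im.
Qed.

(** The characteristic function yields only [E|L|^2]. Covariances follow by polarization, comparing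
    both sides on the directions [t + conjc c u] for [c = 1] and [c = i]. *)
Lemma linear_form_covariance t u :
  Ec P (fun w => linear_form t w * conjc (linear_form u w)) = \sum_i cqf (t i) (S i) (u i).
Proof.
have ci a b : cint P (fun w => linear_form a w * conjc (linear_form b w)).
  exact: (cint_form2 GG (gaussian_form GG (linear_form_in a))
    (gaussian_conj_form GG (linear_form_in b))).
pose K a b := Ec P (fun w => linear_form a w * conjc (linear_form b w)).
pose Q (a b : dir) := \sum_i cqf (a i) (S i) (b i).
have KQ a : K a a = Q a a by exact: Ec_linear_form_sqr.
have key c : conjc c * K t u + c * K u t = conjc c * Q t u + c * Q u t.
  have := KQ (fun i => t i + conjc c *: u i).
  have -> : K (fun i => t i + conjc c *: u i) (fun i => t i + conjc c *: u i) =
      K t t + (conjc c * K t u + (c * K u t + (c * conjc c) * K u u)).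
    rewrite /K linear_formD linear_formZ.
    rewrite (_ : (fun w => _) = (fun w => linear_form t w * conjc (linear_form t w) +
      (conjc c * (linear_form t w * conjc (linear_form u w)) +
       (c * (linear_form u w * conjc (linear_form t w)) +
        (c * conjc c) * (linear_form u w * conjc (linear_form u w)))))); last first.
      by apply/funext => w; rewrite conj_add conj_mul; ring.
    have z1 := cintZ (conjc c) (ci t u); have z2 := cintZ c (ci u t).
    have z3 := cintZ (c * conjc c) (ci u u).
    rewrite (EcD (ci t t) (cintD z1 (cintD z2 z3))) (EcD z1 (cintD z2 z3)) (EcD z2 z3).
    by rewrite (EcZ _ (ci t u)) (EcZ _ (ci u t)) (EcZ _ (ci u u)).
  have -> : Q (fun i => t i + conjc c *: u i) (fun i => t i + conjc c *: u i) =
      Q t t + (conjc c * Q t u + (c * Q u t + (c * conjc c) * Q u u)).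
    rewrite /Q !mulr_sumr -!big_split/=; apply: eq_bigr => i _.
    by rewrite cqfDl !cqfDr !cqfZl !cqfZr conjcK; ring.
  by rewrite !KQ => /addrI; rewrite !addrA => /addIr.
have := key (0 +i* 1); have := key 1.
have -> : conjc (1 : C) = 1 by exact: (conj_real 1).
have -> : conjc (0 +i* 1 : C) = - (0 +i* 1) by apply: complex_ext; rewrite //= oppr0.
rewrite -/(K t u) -/(Q t u) => e1 e2.
exact: (sesqui_polarization e1 e2).
Qed.

Definition coord_form i (x : 'cV[C]_(crv_dim (F i))) (w : Om) : C :=
  cdot x (crv_fun (F i) w - mu i).

Definition coord_dir i (x : 'cV[C]_(crv_dim (F i))) : dir :=
  @eqtype.dfwith I (fun j => 'cV[C]_(crv_dim (F j))) (fun=> 0) i x.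

Lemma coord_formE i (x : 'cV[C]_(crv_dim (F i))) : coord_form x = linear_form (coord_dir x).
Proof.
apply/funext => w; rewrite /linear_form (bigD1 i)//= /coord_dir dfwith_in big1 ?addr0// => j ji.
by rewrite dfwith_out 1?eq_sym// cdot0l.
Qed.

Lemma coord_form_in i (x : 'cV[C]_(crv_dim (F i))) : linear_forms (coord_form x).
Proof. by rewrite coord_formE; exact: linear_form_in. Qed.

Lemma coord_covariance i (x y : 'cV[C]_(crv_dim (F i))) :
  Ec P (fun w => coord_form x w * conjc (coord_form y w)) = cqf x (S i) y.
Proof.
rewrite !coord_formE linear_form_covariance (bigD1 i)//= /coord_dir !dfwith_in.
rewrite big1 ?addr0// => j ji.
by rewrite dfwith_out 1?eq_sym// cqf0l.
Qed.

Lemma coord_covariance0 i j (x : 'cV[C]_(crv_dim (F i))) (y : 'cV[C]_(crv_dim (F j))) :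
  i != j -> Ec P (fun w => coord_form x w * conjc (coord_form y w)) = 0.
Proof.
move=> ij; rewrite !coord_formE linear_form_covariance big1// => k _.
have [<-|ik] := eqVneq i k.
  by rewrite /coord_dir (dfwith_out _ _ (_ : j != i)) 1?eq_sym// cqf0r.
by rewrite /coord_dir dfwith_out// cqf0l.
Qed.

End IndependentGaussianFamily.

(** * Covariance matrices, matched filters and pilot estimates *)

Section VectorCovariance.
Context {R : realType} {d : measure_display} {Om : measurableType d}.
Variable P : probability Om R.
Local Notation C := R[i].
Variable G : set (Om -> C).
Hypothesis GG : gaussian_space P G.

Definition gaussian_vector n (X : Om -> 'cV[C]_n) : Prop :=
  forall j, G (fun w => X w j 0).

(** No mean is subtracted: members of a Gaussian space are centred. *)
Definition covmx m n (X : Om -> 'cV[C]_m) (Y : Om -> 'cV[C]_n) : 'M[C]_(m, n) :=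
  \matrix_(i, j) Ec P (fun w => X w i 0 * conjc (Y w j 0)).

Lemma cint_gaussian_conj X Y : G X -> G Y -> cint P (fun w => X w * conjc (Y w)).
Proof.
by move=> GX GY; exact: (cint_form2 GG (gaussian_form GG GX) (gaussian_conj_form GG GY)).
Qed.

Lemma gaussian_vectorD n (X Y : Om -> 'cV[C]_n) :
  gaussian_vector X -> gaussian_vector Y -> gaussian_vector (fun w => X w + Y w).
Proof.
move=> GX GY j; have := gaussian_add GG (GX j) (GY j); congr G.
by apply/funext => w; rewrite mxE.
Qed.

Lemma gaussian_vectorZ n c (X : Om -> 'cV[C]_n) :
  gaussian_vector X -> gaussian_vector (fun w => c *: X w).
Proof.
move=> GX j; have := gaussian_scale GG c (GX j); congr G.
by apply/funext => w; rewrite mxE.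
Qed.

(** A [gaussian_space] is not postulated to be inhabited, so a member must be shown to produce zero;
    this is the purpose of the witnesses [X0] and [j0] below. *)
Lemma gaussian_zero X : G X -> G (fun=> 0).
Proof.
move=> GX; have := gaussian_scale GG 0 GX; congr G.
by apply/funext => w; rewrite mul0r.
Qed.

Lemma gaussian_sum X0 (J : Type) (r : seq J) (Q : pred J) (X : J -> Om -> C) : G X0 ->
  (forall i, G (X i)) -> G (fun w => \sum_(i <- r | Q i) X i w).
Proof.
move=> GX0 GX; elim: r => [|i r IH].
  by under eq_fun do rewrite big_nil; exact: gaussian_zero GX0.
have [Qi|nQi] := boolP (Q i).
  by under eq_fun do rewrite big_cons Qi; exact: (gaussian_add GG (GX i) IH).
by under eq_fun do rewrite big_cons (negbTE nQi).
Qed.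

Lemma gaussian_vector_sum n (X0 : Om -> 'cV[C]_n) (J : Type) (r : seq J) (Q : pred J)
    (X : J -> Om -> 'cV[C]_n) :
  gaussian_vector X0 -> (forall i, gaussian_vector (X i)) ->
  gaussian_vector (fun w => \sum_(i <- r | Q i) X i w).
Proof.
move=> GX0 GX j.
have := @gaussian_sum _ J r Q (fun i w => X i w j 0) (GX0 j) (fun i => GX i j); congr G.
by apply/funext => w; rewrite summxE.
Qed.

Lemma gaussian_vectorM m n (A : 'M[C]_(m, n)) (X : Om -> 'cV[C]_n) (j0 : 'I_n) :
  gaussian_vector X -> gaussian_vector (fun w => A *m X w).
Proof.
move=> GX j.
have := @gaussian_sum _ _ (index_enum 'I_n) xpredT (fun i w => A j i * X w i 0) (GX j0)
  (fun i => gaussian_scale GG (A j i) (GX i)); congr G.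
by apply/funext => w; rewrite mxE.
Qed.

Lemma ctr_covmx m n (X : Om -> 'cV[C]_m) (Y : Om -> 'cV[C]_n) :
  gaussian_vector X -> gaussian_vector Y -> ctr (covmx X Y) = covmx Y X.
Proof.
move=> GX GY; apply/matrixP => i j; rewrite !mxE -Ec_conj; last exact: cint_gaussian_conj.
by congr (Ec P _); apply/funext => w; rewrite conj_mul conjcK mulrC.
Qed.

Lemma covmxDl m n (X Y : Om -> 'cV[C]_m) (Z : Om -> 'cV[C]_n) :
  gaussian_vector X -> gaussian_vector Y -> gaussian_vector Z ->
  covmx (fun w => X w + Y w) Z = covmx X Z + covmx Y Z.
Proof.
move=> GX GY GZ; apply/matrixP => i j; rewrite !mxE -EcD; try exact: cint_gaussian_conj.
by congr (Ec P _); apply/funext => w; rewrite mxE mulrDl.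
Qed.

Lemma covmxMl m n p (A : 'M[C]_(p, m)) (X : Om -> 'cV[C]_m) (Z : Om -> 'cV[C]_n) :
  gaussian_vector X -> gaussian_vector Z ->
  covmx (fun w => A *m X w) Z = A *m covmx X Z.
Proof.
move=> GX GZ; apply/matrixP => i j; rewrite !mxE.
under [X in Ec P X]eq_fun do rewrite mxE mulr_suml.
rewrite Ec_sum => [|k]; last first.
  under eq_fun do rewrite -mulrA.
  by apply: cintZ; exact: cint_gaussian_conj.
apply: eq_bigr => k _; rewrite mxE -EcZ; last exact: cint_gaussian_conj.
by congr (Ec P _); apply/funext => w; rewrite mulrA.
Qed.

Lemma covmxZl m n c (X : Om -> 'cV[C]_m) (Z : Om -> 'cV[C]_n) :
  gaussian_vector X -> gaussian_vector Z ->
  covmx (fun w => c *: X w) Z = c *: covmx X Z.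
Proof.
move=> GX GZ; rewrite -mul_scalar_mx -covmxMl//; congr covmx.
by apply/funext => w; rewrite mul_scalar_mx.
Qed.

Lemma covmx_suml m n (X0 : Om -> 'cV[C]_m) (J : Type) (r : seq J) (Q : pred J)
    (X : J -> Om -> 'cV[C]_m) (Z : Om -> 'cV[C]_n) : gaussian_vector X0 ->
  (forall i, gaussian_vector (X i)) -> gaussian_vector Z ->
  covmx (fun w => \sum_(i <- r | Q i) X i w) Z = \sum_(i <- r | Q i) covmx (X i) Z.
Proof.
move=> GX0 GX GZ; elim: r => [|i r IH].
  rewrite big_nil; apply/matrixP => i j; rewrite !mxE -[RHS](Ec_cst P 0).
  by congr (Ec P _); apply/funext => w; rewrite big_nil mxE mul0r.
rewrite big_cons -IH; case: (boolP (Q i)) => Qi.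
  rewrite -covmxDl//; last exact: gaussian_vector_sum GX0 GX.
  by congr covmx; apply/funext => w; rewrite big_cons Qi.
by congr covmx; apply/funext => w; rewrite big_cons (negbTE Qi).
Qed.

Section MatchedFilter.
Variables (n : nat) (al be : 'cV[C]_n) (E H : Om -> 'cV[C]_n).
Hypotheses (GE : gaussian_vector E) (GH : gaussian_vector H).

Local Notation z := (fun w => cdot (al + E w) (be + H w)).

Let zE : z = (fun w => \sum_a (al a 0 + E w a 0)^*%C * (be a 0 + H w a 0)).
Proof. by apply/funext => w; rewrite cdotE; apply: eq_bigr => a _; rewrite !mxE. Qed.

Lemma Ec_cdot : Ec P z = cdot al be + \tr (covmx H E).
Proof.
rewrite zE (Ec_matched_filter GG (fun a => al a 0) (fun a => be a 0) GE GH).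
rewrite big_split/= cdotE; congr (_ + _); apply: eq_bigr => a _; rewrite mxE.
by congr (Ec P _); apply/funext => w; rewrite mulrC.
Qed.

Lemma Er_sqmod_cdot : (Er P (fun w => sqmod (z w)))%:C =
  Ec P z * conjc (Ec P z) + cqf al (covmx H H) al + cqf be (covmx E E) be
  + \tr (covmx E E *m covmx H H).
Proof.
rewrite zE (Er_sqmod_matched_filter GG (fun a => al a 0) (fun a => be a 0) GE GH).
have cE a b : Ec P (fun w => (E w a 0)^*%C * E w b 0) = covmx E E b a.
  by rewrite mxE; congr (Ec P _); apply/funext => w; rewrite mulrC.
have cH a b : Ec P (fun w => H w a 0 * (H w b 0)^*%C) = covmx H H a b by rewrite mxE.
have qE (x : 'cV[C]_n) (A : 'M[C]_n) :
    cqf x A x = \sum_a \sum_b (x a 0)^*%C * x b 0 * A a b.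
  rewrite /cqf mxE exchange_big/=; apply: eq_bigr => b _; rewrite mxE mulr_suml.
  by apply: eq_bigr => a _; rewrite !mxE mulrAC.
congr (_ + _ + _ + _).
- by rewrite qE; apply: eq_bigr => a _; apply: eq_bigr => b _; rewrite cH.
- rewrite qE exchange_big/=; apply: eq_bigr => b _; apply: eq_bigr => a _.
  by rewrite cE (mulrC (be a 0)).
rewrite exchange_big/= /mxtrace; apply: eq_bigr => b _; rewrite mxE.
by apply: eq_bigr => a _; rewrite cE cH.
Qed.

End MatchedFilter.

Section PilotEstimate.
(** Both receivers are instances: the satellite with [n = N], and the APs together with [n = M] and
    diagonal matrices. The filter [A] introduced below stays arbitrary until then. *)
Variables (n K : nat) (h : 'I_K -> Om -> 'cV[C]_n) (v : Om -> 'cV[C]_n).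
Variables (Rh : 'I_K -> 'M[C]_n) (Sv : 'M[C]_n) (Pk : {set 'I_K}).
Hypotheses (Gh : forall k, gaussian_vector (h k)) (Gv : gaussian_vector v).
Hypothesis covh : forall k k', covmx (h k) (h k') = if k == k' then Rh k else 0.
Hypothesis covhv : forall k, covmx (h k) v = 0.
Hypothesis covv : covmx v v = Sv.
Variable s : R.

Definition pilot_signal w : 'cV[C]_n := s%:C *: (\sum_(k in Pk) h k w) + v w.

Lemma pilot_signal_gaussian : gaussian_vector pilot_signal.
Proof.
apply: gaussian_vectorD => //; apply: gaussian_vectorZ.
exact: (gaussian_vector_sum _ _ Gv Gh).
Qed.

Let Gs := pilot_signal_gaussian.
Let Gsum : gaussian_vector (fun w => \sum_(k in Pk) h k w).
Proof. exact: (gaussian_vector_sum _ _ Gv Gh). Qed.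

(** This is pilot contamination: the one received signal is correlated with every channel in [Pk],
    not only with that of the intended user. *)
Lemma covmx_pilot k' :
  covmx pilot_signal (h k') = if k' \in Pk then s%:C *: Rh k' else 0.
Proof.
rewrite /pilot_signal covmxDl//; last exact: gaussian_vectorZ.
rewrite covmxZl// (covmx_suml _ _ Gv Gh)//.
rewrite -(ctr_covmx (Gh k') Gv) covhv ctr0 addr0.
case: ifPn => kP.
  congr (_ *: _); rewrite (bigD1 k')//= covh eqxx big1 ?addr0// => i /andP[_ ik].
  by rewrite covh (negbTE ik).
rewrite big1 ?scaler0// => i iP; rewrite covh; case: eqP => // ik.
by rewrite ik (negbTE kP) in iP.
Qed.

Lemma covmx_pilot_noise : covmx pilot_signal v = Sv.
Proof.
rewrite /pilot_signal covmxDl//; last exact: gaussian_vectorZ.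
rewrite covmxZl// (covmx_suml _ _ Gv Gh)// big1 ?scaler0 ?add0r// => i _.
Qed.

Hypothesis Rh_hermitian : forall k, ctr (Rh k) = Rh k.

Lemma covmx_pilot_pilot : ctr Sv = Sv ->
  covmx pilot_signal pilot_signal = \sum_(k in Pk) ((s ^+ 2)%:C *: Rh k) + Sv.
Proof.
move=> hSv; rewrite {1}/pilot_signal covmxDl//; last exact: gaussian_vectorZ.
rewrite covmxZl// (covmx_suml _ _ Gv Gh)//.
rewrite -(ctr_covmx Gs Gv) covmx_pilot_noise hSv; congr (_ + _).
rewrite scaler_sumr; apply: eq_bigr => k kP.
rewrite -(ctr_covmx Gs (Gh k)) covmx_pilot kP ctr_real_scale Rh_hermitian scalerA.
by congr (_ *: _); apply: complex_ext => /=; ring.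
Qed.

Variable A : 'M[C]_n.

Definition pilot_estimate w : 'cV[C]_n := A *m pilot_signal w.

Lemma pilot_estimate_gaussian : gaussian_vector pilot_estimate.
Proof. by move=> j; exact: (gaussian_vectorM A j Gs j). Qed.

Lemma covmx_estimate k' : covmx (h k') pilot_estimate =
  if k' \in Pk then s%:C *: (Rh k' *m ctr A) else 0.
Proof.
rewrite -(ctr_covmx pilot_estimate_gaussian (Gh k')) covmxMl// covmx_pilot.
case: ifP => _; last by rewrite mulmx0 ctr0.
by rewrite ctrM ctr_real_scale Rh_hermitian scalemxAl.
Qed.

Lemma covmx_estimate_estimate : ctr Sv = Sv ->
  covmx pilot_estimate pilot_estimate =
  A *m (\sum_(k in Pk) ((s ^+ 2)%:C *: Rh k) + Sv) *m ctr A.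
Proof.
move=> hSv; rewrite {1}/pilot_estimate covmxMl//; last exact: pilot_estimate_gaussian.
rewrite -(ctr_covmx pilot_estimate_gaussian Gs) covmxMl// ctrM (ctr_covmx Gs Gs).
by rewrite covmx_pilot_pilot// mulmxA.
Qed.

(** Meant for the data noises, which are uncorrelated with all that is received in the pilot
    phase. *)
Lemma covmx_estimate0 q (Z : Om -> 'cV[C]_q) : gaussian_vector Z ->
  (forall k, covmx Z (h k) = 0) -> covmx Z v = 0 -> covmx Z pilot_estimate = 0.
Proof.
move=> GZ Zh Zv; rewrite -(ctr_covmx pilot_estimate_gaussian GZ) covmxMl//.
rewrite /pilot_signal covmxDl//; last exact: gaussian_vectorZ.
rewrite covmxZl// (covmx_suml _ _ Gv Gh)// big1 => [|k _]; last first.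
  by rewrite -(ctr_covmx GZ (Gh k)) Zh ctr0.
by rewrite -(ctr_covmx GZ Gv) Zv ctr0 scaler0 addr0 mulmx0 ctr0.
Qed.

End PilotEstimate.

Section Stacking.
Variables m n : nat.
Implicit Types (X : Om -> 'cV[C]_m) (Y : Om -> 'cV[C]_n).

Lemma gaussian_vector_col X Y : gaussian_vector X -> gaussian_vector Y ->
  gaussian_vector (fun w => col_mx (X w) (Y w)).
Proof.
move=> GX GY j; case: (split_ordP j) => a ->.
  by have := GX a; congr G; apply/funext => w; rewrite col_mxEu.
by have := GY a; congr G; apply/funext => w; rewrite col_mxEd.
Qed.

Lemma covmx_col X Y X' Y' :
  covmx (fun w => col_mx (X w) (Y w)) (fun w => col_mx (X' w) (Y' w)) =
  block_mx (covmx X X') (covmx X Y') (covmx Y X') (covmx Y Y').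
Proof.
apply/matrixP => i j; case: (split_ordP i) => a ->; case: (split_ordP j) => b ->;
  rewrite ?(block_mxEul, block_mxEur, block_mxEdl, block_mxEdr) !mxE;
  by congr (Ec P _); apply/funext => w; rewrite ?col_mxEu ?col_mxEd.
Qed.

End Stacking.

End VectorCovariance.

(** * Stacked vectors, and invertibility of the pilot covariance *)

Section PilotInverse.
Variable R : realType.
Local Notation C := R[i].

Lemma cdot_col m n (x x' : 'cV[C]_m) (y y' : 'cV[C]_n) :
  cdot (col_mx x y) (col_mx x' y') = cdot x x' + cdot y y'.
Proof.
rewrite !cdotE big_split_ord/=; congr (_ + _); apply: eq_bigr => j _.
  by rewrite !col_mxEu.
by rewrite !col_mxEd.
Qed.

Lemma ctr_col m n (x : 'cV[C]_m) (y : 'cV[C]_n) : ctr (col_mx x y) = row_mx (ctr x) (ctr y).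
Proof. by rewrite /ctr map_col_mx tr_col_mx. Qed.

(** AP channels have zero mean, so a stacked mean is zero in its lower block and sees only the
    satellite block of a covariance. *)
Lemma cqf_col0 m n (x : 'cV[C]_m) (A11 : 'M[C]_m) A12 A21 (A22 : 'M[C]_n) :
  cqf (col_mx x 0) (block_mx A11 A12 A21 A22) (col_mx x 0) = cqf x A11 x.
Proof.
by rewrite /cqf ctr_col ctr0 mul_row_block !mul0mx !addr0 mul_row_col mulmx0 addr0.
Qed.

Lemma diag_mxM n (x y : 'I_n -> C) :
  diag_mx (\row_j x j) *m diag_mx (\row_j y j) = diag_mx (\row_j (x j * y j)).
Proof. by rewrite mulmx_diag; congr diag_mx; apply/rowP => j; rewrite !mxE. Qed.

Lemma cdot_eq0 n (x : 'cV[C]_n) : cdot x x = 0 -> x = 0.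
Proof.
rewrite cdotE => /eqP; rewrite psumr_eq0 => [/allP h|j _].
  apply/matrixP => j k; rewrite (ord1 k) [RHS]mxE.
  have /= := h j (mem_index_enum _); rewrite mulf_eq0 => /orP[|/eqP//].
  case: (x j 0) => a b; rewrite !eq_complex /= oppr_eq0 => /andP[/eqP-> /eqP->].
  by [].
exact: conj_mul_ge0.
Qed.

Variables (n : nat) (J : finType) (Q : {set J}) (B : J -> 'M[C]_n) (a s2 : R).
Hypotheses (a0 : 0 <= a) (s20 : 0 < s2) (Bpsd : forall k, psd (B k)).

Let M := \sum_(k in Q) (a%:C *: B k) + (s2%:C)%:M.

Lemma ctr_pilot_matrix : ctr M = M.
Proof.
have hs : ctr ((s2%:C)%:M : 'M[C]_n) = (s2%:C)%:M by have [] := psd_scalar n (ltW s20).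
rewrite /M ctrD hs; congr (_ + _).
rewrite (big_morph _ (@ctrD _ _ _) (@ctr0 _ _ _)); apply: eq_bigr => k _.
by rewrite ctr_real_scale; have [-> _] := Bpsd k.
Qed.

(** The quadratic form is a nonnegative part plus [s2] times the squared norm, so it vanishes only
    at zero. *)
Lemma pilot_matrix_unit : M \in unitmx.
Proof.
rewrite -row_free_unit -kermx_eq0; apply/negPn/negP => /rowV0Pn[v /sub_kermxP vM v0].
(* [kermx] gives a row vector [v] with [v M = 0], while [cqf] takes columns; with [x = v^H] the form
   starts with [v M]. *)
pose x := ctr v.
have q0 : cqf x M x = 0 by rewrite /cqf /x ctrK vM mul0mx mxE.
have qM : cqf x M x = \sum_(k in Q) a%:C * cqf x (B k) x + s2%:C * cdot x x.
  rewrite /M /cqf mulmxDr mulmxDl mxE; congr (_ + _); last first.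
    by rewrite mul_mx_scalar -scalemxAl mxE.
  rewrite mulmx_sumr mulmx_suml summxE; apply: eq_bigr => k _.
  by rewrite -scalemxAr -scalemxAl mxE.
have p1 : 0 <= \sum_(k in Q) a%:C * cqf x (B k) x.
  by apply: sumr_ge0 => k _; rewrite mulr_ge0 ?ler0c//; have [_] := Bpsd k; exact.
have p2 : 0 <= cdot x x.
  have [_ /(_ x)] := @psd_scalar R n 1 ler01.
  by rewrite /cqf mulmx1.
have p3 : 0 <= s2%:C * cdot x x by rewrite mulr_ge0// ler0c ltW.
move/eqP: q0; rewrite qM paddr_eq0//.
move=> /andP[_]; rewrite mulf_eq0 => /orP[|/eqP/cdot_eq0 xz].
  by rewrite eq_complex /= eqxx andbT gt_eqF.
by case/eqP: v0; rewrite -(ctrK v) -/x xz ctr0.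
Qed.

Lemma ctr_pilot_inverse : ctr (invmx M) = invmx M.
Proof.
have uM := pilot_matrix_unit.
have h : ctr (invmx M) *m M = 1%:M.
  rewrite -{2}ctr_pilot_matrix -ctrM mulmxV//.
  by have [] := @psd_scalar R n 1 ler01.
by rewrite -[LHS]mulmx1 -(mulmxV uM) mulmxA h mul1mx.
Qed.

End PilotInverse.

(** * The satellite-terrestrial uplink *)

Section UplinkModel.
Local Open Scope complex_scope.
Context {R : realType} (M K N Tp : nat) (p sa2 ss2 : R).
Local Notation C := R[i].
Context (beta : 'I_M -> 'I_K -> R) (gbar : 'I_K -> 'cV[C]_N)
  (Rk : 'I_K -> 'M[C]_N) (pil : 'I_K -> 'I_Tp)
  {d : measure_display} {Om : measurableType d} (P : probability Om R)
  (gAP : 'I_M -> 'I_K -> Om -> C) (gS : 'I_K -> Om -> 'cV[C]_N)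
  (nP : 'I_M -> 'I_Tp -> Om -> C) (wP : 'I_Tp -> Om -> 'cV[C]_N)
  (wS : Om -> 'cV[C]_N) (wA : 'I_M -> Om -> C).
Hypotheses (p0 : 0 < p) (sa0 : 0 < sa2) (ss0 : 0 < ss2).
Hypothesis beta0 : forall m k', 0 < beta m k'.
Hypothesis Rpsd : forall k', psd (Rk k').
Hypothesis CN_gAP : forall m k', isCN1 P (gAP m k') 0 (beta m k')%:C.
Hypothesis CN_gS : forall k', isCN P (gS k') (gbar k') (Rk k').
Hypothesis CN_nP : forall m t, isCN1 P (nP m t) 0 sa2%:C.
Hypothesis CN_wP : forall t, isCN P (wP t) 0 (ss2%:C)%:M.
Hypothesis CN_wS : isCN P wS 0 (ss2%:C)%:M.
Hypothesis CN_wA : forall m, isCN1 P (wA m) 0 sa2%:C.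
Local Notation F := (rv_family gAP gS nP wP wS wA).
Hypothesis indF : mutually_independent P F.

Local Notation index :=
  ((('I_M * 'I_K) + 'I_K) + ((('I_M * 'I_Tp) + 'I_Tp) + (unit + 'I_M)))%type.

Definition family_mean (i : index) : 'cV[C]_(crv_dim (F i)) :=
  match i return 'cV[C]_(crv_dim (F i)) with
  | inl (inl (m, k)) => (0 : C)%:M
  | inl (inr k) => gbar k
  | inr (inl (inl (m, t))) => (0 : C)%:M
  | inr (inl (inr t)) => 0
  | inr (inr (inl _)) => 0
  | inr (inr (inr m)) => (0 : C)%:M
  end.

Definition family_cov (i : index) : 'M[C]_(crv_dim (F i)) :=
  match i return 'M[C]_(crv_dim (F i)) with
  | inl (inl (m, k)) => ((beta m k)%:C)%:M
  | inl (inr k) => Rk k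
  | inr (inl (inl (m, t))) => (sa2%:C)%:M
  | inr (inl (inr t)) => (ss2%:C)%:M
  | inr (inr (inl _)) => (ss2%:C)%:M
  | inr (inr (inr m)) => (sa2%:C)%:M
  end.

Let family_psd i : psd (family_cov i).
Proof.
case: i => [[[m k]|k]|[[[m t]|t]|[u|m]]] /=; try exact: psd_scalar (ltW _).
exact: Rpsd.
Qed.

Let family_CN i : isCN P (crv_fun (F i)) (family_mean i) (family_cov i).
Proof.
case: i => [[[m k]|k]|[[[m t]|t]|[u|m]]] /=.
- exact: CN_gAP.
- exact: CN_gS.
- exact: CN_nP.
- exact: CN_wP.
- exact: CN_wS.
- exact: CN_wA.
Qed.

Local Notation G := (linear_forms family_mean).

Let GG : gaussian_space P G.
Proof. exact: (linear_forms_gaussian family_CN indF). Qed.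

Definition coord (i : index) (j : 'I_(crv_dim (F i))) (w : Om) : C :=
  (crv_fun (F i) w - family_mean i) j 0.

Let coordE i j : coord (i := i) j = coord_form family_mean (delta_mx j 0).
Proof. by apply/funext => w; rewrite /coord_form cdot_delta. Qed.

Lemma coord_in i (j : 'I_(crv_dim (F i))) : G (coord j).
Proof. by rewrite coordE; exact: coord_form_in. Qed.

Lemma Ec_coord i (j j' : 'I_(crv_dim (F i))) :
  Ec P (fun w => coord j w * conjc (coord j' w)) = family_cov i j j'.
Proof. by rewrite !coordE (coord_covariance family_psd family_CN indF) cqf_delta. Qed.

Lemma Ec_coord0 i i' (j : 'I_(crv_dim (F i))) (j' : 'I_(crv_dim (F i'))) :
  i != i' -> Ec P (fun w => coord j w * conjc (coord j' w)) = 0.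
Proof.
by move=> ii'; rewrite !coordE (coord_covariance0 family_psd family_CN indF).
Qed.

Definition hS k w : 'cV[C]_N := gS k w - gbar k.
Definition hA k w : 'cV[C]_M := \col_m gAP m k w.
Definition vA t w : 'cV[C]_M := \col_m nP m t w.

Let hS_coord k j : (fun w => hS k w j 0) = coord (i := inl (inr k)) j.
Proof. by []. Qed.

Let gAP_coord m k : gAP m k = coord (i := inl (inl (m, k))) ord0.
Proof. by apply/funext => w; rewrite /coord !mxE /= subr0. Qed.

Let nP_coord m t : nP m t = coord (i := inr (inl (inl (m, t)))) ord0.
Proof. by apply/funext => w; rewrite /coord !mxE /= subr0. Qed.

Let wP_coord t j : (fun w => wP t w j 0) = coord (i := inr (inl (inr t))) j.
Proof. by apply/funext => w; rewrite /coord !mxE /= subr0. Qed.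

Let wS_coord j : (fun w => wS w j 0) = coord (i := inr (inr (inl tt))) j.
Proof. by apply/funext => w; rewrite /coord !mxE /= subr0. Qed.

Let wA_coord m : wA m = coord (i := inr (inr (inr m))) ord0.
Proof. by apply/funext => w; rewrite /coord !mxE /= subr0. Qed.

Let hA_coord k m : (fun w => hA k w m 0) = coord (i := inl (inl (m, k))) ord0.
Proof. by rewrite -gAP_coord; apply/funext => w; rewrite mxE. Qed.

Let vA_coord t m : (fun w => vA t w m 0) = coord (i := inr (inl (inl (m, t)))) ord0.
Proof. by rewrite -nP_coord; apply/funext => w; rewrite mxE. Qed.

Let G_hS k : gaussian_vector G (hS k). Proof. by move=> j; rewrite hS_coord; exact: coord_in. Qed.
Let G_hA k : gaussian_vector G (hA k). Proof. by move=> j; rewrite hA_coord; exact: coord_in. Qed.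
Let G_vA t : gaussian_vector G (vA t). Proof. by move=> j; rewrite vA_coord; exact: coord_in. Qed.
Let G_wP t : gaussian_vector G (wP t). Proof. by move=> j; rewrite wP_coord; exact: coord_in. Qed.
Let G_wS : gaussian_vector G wS. Proof. by move=> j; rewrite wS_coord; exact: coord_in. Qed.
Let G_wA m : G (wA m). Proof. by rewrite wA_coord; exact: coord_in. Qed.

(** Every entry of a channel or noise vector is a coordinate of the pooled family. Covariances are
    then decided by comparing family indices: an entry of [family_cov] within one block, zero across
    blocks. *)
Lemma covmx_coord m n (X : Om -> 'cV[C]_m) (Y : Om -> 'cV[C]_n)
    (iX : 'I_m -> index) (iY : 'I_n -> index)
    (jX : forall a, 'I_(crv_dim (F (iX a)))) (jY : forall a, 'I_(crv_dim (F (iY a)))) :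
  (forall a, (fun w => X w a 0) = coord (jX a)) ->
  (forall a, (fun w => Y w a 0) = coord (jY a)) ->
  forall a b, covmx P X Y a b = Ec P (fun w => coord (jX a) w * conjc (coord (jY b) w)).
Proof.
move=> hX hY a b; rewrite mxE; congr (Ec P _); apply/funext => w.
by rewrite -(hX a) -(hY b).
Qed.

Let cov_hS k k' : covmx P (hS k) (hS k') = if k == k' then Rk k else 0.
Proof.
apply/matrixP => a b; rewrite (covmx_coord (hS_coord k) (hS_coord k')).
have [<-|kk'] := eqVneq k k'; first exact: Ec_coord.
by rewrite Ec_coord0 ?mxE.
Qed.

Let cov_hS_wP k t : covmx P (hS k) (wP t) = 0.
Proof.
by apply/matrixP => a b; rewrite (covmx_coord (hS_coord k) (wP_coord t)) Ec_coord0 ?mxE.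
Qed.

Let cov_wP t : covmx P (wP t) (wP t) = (ss2%:C)%:M.
Proof.
by apply/matrixP => a b; rewrite (covmx_coord (wP_coord t) (wP_coord t)) Ec_coord.
Qed.

Let cov_wS : covmx P wS wS = (ss2%:C)%:M.
Proof.
by apply/matrixP => a b; rewrite (covmx_coord wS_coord wS_coord) Ec_coord.
Qed.

Let cov_wS_hS k : covmx P wS (hS k) = 0.
Proof.
by apply/matrixP => a b; rewrite (covmx_coord wS_coord (hS_coord k)) Ec_coord0 ?mxE.
Qed.

Let cov_wS_wP t : covmx P wS (wP t) = 0.
Proof.
by apply/matrixP => a b; rewrite (covmx_coord wS_coord (wP_coord t)) Ec_coord0 ?mxE.
Qed.

Let cov_hA k k' : covmx P (hA k) (hA k') =
  if k == k' then diag_mx (\row_m (beta m k)%:C) else 0.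
Proof.
apply/matrixP => a b; rewrite (covmx_coord (hA_coord k) (hA_coord k')).
(* Each AP-user pair is a block of its own, which makes the covariance over the APs diagonal. *)
have [ab|ab] := eqVneq (a, k) (b, k').
  case: ab => -> ->; rewrite Ec_coord eqxx !mxE eqxx /= !mulr1n.
  by rewrite eqxx.
rewrite Ec_coord0//; case: eqP => kk'; rewrite !mxE //.
case: eqP => // ab'; move: ab; rewrite ab' kk' eqxx //.
Qed.

Let cov_hA_vA k t : covmx P (hA k) (vA t) = 0.
Proof.
by apply/matrixP => a b; rewrite (covmx_coord (hA_coord k) (vA_coord t)) Ec_coord0 ?mxE.
Qed.

Let cov_vA t : covmx P (vA t) (vA t) = (sa2%:C)%:M.
Proof.
apply/matrixP => a b; rewrite (covmx_coord (vA_coord t) (vA_coord t)).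
have [->|ab] := eqVneq a b; first by rewrite Ec_coord !mxE !eqxx.
rewrite Ec_coord0 ?mxE ?(negbTE ab)//.
by apply: contra ab => /eqP[->].
Qed.

Let cov_hS_hA k k' : covmx P (hS k) (hA k') = 0.
Proof.
by apply/matrixP => a b; rewrite (covmx_coord (hS_coord k) (hA_coord k')) Ec_coord0 ?mxE.
Qed.

Variable k : 'I_K.
Local Notation s := (Num.sqrt (ptp Tp p)).
Local Notation Pk := (Pset pil k).
Local Notation Phik := (Phi p ss2 Rk pil k).
Local Notation c m := (cAP p sa2 beta pil m k).
Local Notation gamma m := (gammaAP p sa2 beta pil m k).
Local Notation D m := (\sum_(k' in Pk) ptp Tp p * beta m k' + sa2).

(** [Tp] is positive because the pilot [pil k] inhabits ['I_Tp]. *)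
Let ptp0 : 0 < ptp Tp p.
Proof. by rewrite mulr_gt0// ltr0n; case: (pil k) => t; case: Tp. Qed.

Let s2 : s ^+ 2 = ptp Tp p.
Proof. by rewrite sqr_sqrtr// ltW. Qed.

Let D0 m : 0 < D m.
Proof.
rewrite ltr_wpDl// sumr_ge0// => k' _.
by rewrite mulr_ge0 ?ltW.
Qed.

(** Centred estimates: the MMSE filters [sqrt(p tau_p) R_k Phi_k] and [diag(c_mk)] applied to the
    centred pilot signals. *)
Definition eS : Om -> 'cV[C]_N :=
  pilot_estimate hS (wP (pil k)) Pk s (s%:C *: (Rk k *m Phik)).
Definition eA : Om -> 'cV[C]_M :=
  pilot_estimate hA (vA (pil k)) Pk s (diag_mx (\row_m (c m)%:C)).

Let G_eS : gaussian_vector G eS.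
Proof. exact: (pilot_estimate_gaussian GG). Qed.

Let G_eA : gaussian_vector G eA.
Proof. exact: (pilot_estimate_gaussian GG). Qed.

Lemma ghatSE w : ghatS p ss2 gbar Rk pil gS wP k w = gbar k + eS w.
Proof.
rewrite /ghatS /eS /pilot_estimate; congr (_ + _).
rewrite -scalemxAl; congr (_ *: (_ *m _)).
rewrite /yS /pilot_signal /hS sumrB scalerBr.
by rewrite addrAC.
Qed.

Lemma ghatAPE m w : ghatAP p sa2 beta pil gAP nP m k w = eA w m 0.
Proof.
rewrite /ghatAP /eA /pilot_estimate mul_diag_mx !mxE; congr (_ * _).
rewrite /yAP; congr (_ * _ + _).
by rewrite summxE; apply: eq_bigr => k' _; rewrite mxE.
Qed.

Let Rherm k' : ctr (Rk k') = Rk k'.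
Proof. by have [] := Rpsd k'. Qed.

Let ctr_scalar n (a : R) : 0 < a -> ctr ((a%:C)%:M : 'M[C]_n) = (a%:C)%:M.
Proof. by move=> a0; have [] := psd_scalar n (ltW a0). Qed.

Let ctr_diag n (a : 'I_n -> R) :
  ctr (diag_mx (\row_j (a j)%:C)) = diag_mx (\row_j (a j)%:C).
Proof.
apply/matrixP => i j; rewrite !mxE eq_sym; case: eqP => [->|_]; rewrite ?mulr0n ?conj_zero//.
by rewrite !mulr1n; apply/eqP; rewrite eq_complex /= oppr0 !eqxx.
Qed.

Let realM (a b : R) : a%:C * b%:C = (a * b)%:C :> C.
Proof. by apply: complex_ext => /=; ring. Qed.

Lemma cov_eS : covmx P eS eS = (ptp Tp p)%:C *: (Rk k *m Phik *m Rk k).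
Proof.
have uB := pilot_matrix_unit Pk (ltW ptp0) ss0 Rpsd.
have hB := ctr_pilot_inverse Pk (ltW ptp0) ss0 Rpsd.
rewrite (covmx_estimate_estimate GG _ G_hS (G_wP _) cov_hS (fun k => cov_hS_wP k _)
   (cov_wP _) s Rherm); last exact: ctr_scalar.
rewrite s2 ctr_real_scale ctrM hB Rherm -!scalemxAl -scalemxAr scalerA.
congr (_ *: _); first by rewrite realM -expr2 s2.
(* The pilot covariance stands between two copies of its inverse, and one copy cancels. *)
by rewrite /Phi -!mulmxA (mulmxA (invmx _) _ (invmx _ *m _)) mulVmx// mul1mx.
Qed.

Lemma cov_hS_eS k' : covmx P (hS k') eS =
  if k' \in Pk then (ptp Tp p)%:C *: (Rk k' *m Phik *m Rk k) else 0.
Proof.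
have hB := ctr_pilot_inverse Pk (ltW ptp0) ss0 Rpsd.
rewrite (covmx_estimate GG _ G_hS (G_wP _) cov_hS (fun k => cov_hS_wP k _) s Rherm).
case: ifP => // _; rewrite ctr_real_scale ctrM hB Rherm -scalemxAr scalerA.
by rewrite realM -expr2 s2 mulmxA.
Qed.

Let ctr_covA k' : ctr (diag_mx (\row_m (beta m k')%:C)) = diag_mx (\row_m (beta m k')%:C).
Proof. exact: ctr_diag. Qed.

Lemma cov_eA : covmx P eA eA = diag_mx (\row_m (gamma m)%:C).
Proof.
rewrite (covmx_estimate_estimate GG _ G_hA (G_vA _) cov_hA (fun k => cov_hA_vA k _)
   (cov_vA _) s ctr_covA); last exact: ctr_scalar.
rewrite s2 ctr_diag.
have -> : \sum_(k' in Pk) ((ptp Tp p)%:C *: diag_mx (\row_m (beta m k')%:C)) + (sa2%:C)%:M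
   = diag_mx (\row_m (D m)%:C) :> 'M[C]_M.
  apply/matrixP => a b; rewrite !mxE summxE.
  have [<-|ab] := eqVneq a b; last first.
    by rewrite !mulr0n addr0 big1// => i _; rewrite !mxE (negbTE ab) mulr0n mulr0.
  rewrite !mulr1n rmorphD rmorph_sum/=; congr (_ + _).
  by apply: eq_bigr => i _; rewrite !mxE eqxx mulr1n realM.
rewrite !diag_mxM; congr diag_mx; apply/rowP => m; rewrite !mxE !realM.
congr (_%:C); rewrite /cAP /gammaAP.
(* The square root becomes a variable [y] with [y^2 = p tau_p], so that [field] can check
   [c_mk^2 D_m = gamma_mk]. *)
move: (D m) (D0 m) s s2 => x x0 y y2; rewrite -y2; field.
by rewrite gt_eqF.
Qed.

Lemma cov_hA_eA k' : covmx P (hA k') eA =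
  if k' \in Pk then diag_mx (\row_m (s * beta m k' * c m)%:C) else 0.
Proof.
rewrite (covmx_estimate GG _ G_hA (G_vA _) cov_hA (fun k => cov_hA_vA k _) s ctr_covA).
case: ifP => // _; rewrite ctr_diag diag_mxM.
apply/matrixP => a b; rewrite !mxE -mulrnAr -mulrA -!realM.
by case: (a == b); rewrite ?mulr1n ?mulr0n ?mulr0.
Qed.

(** The AP gain keeps the form [s * beta m k' * c m] delivered by the covariance; [cross_gain]
    converts it to the ratio of the closed form. *)
Definition signal_mean k' : C := cdot (gbar k) (gbar k') +
  if k' \in Pk then (ptp Tp p)%:C * \tr (Rk k' *m Phik *m Rk k) +
    \sum_(m < M) (s * beta m k' * c m)%:C else 0.

Let alv : 'cV[C]_(N + M) := col_mx (gbar k) 0.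
Let bev k' : 'cV[C]_(N + M) := col_mx (gbar k') 0.
Let Ev w := col_mx (eS w) (eA w).
Let Hv k' w := col_mx (hS k' w) (hA k' w).

Let zzE k' : zz p sa2 ss2 beta gbar Rk pil gAP gS nP wP k k' =
  fun w => cdot (alv + Ev w) (bev k' + Hv k' w).
Proof.
apply/funext => w; rewrite /zz !add_col_mx cdot_col !add0r; congr (_ + _).
  by rewrite ghatSE /hS (addrC (gbar k')) subrK.
rewrite cdotE; apply: eq_bigr => m _; rewrite ghatAPE.
by congr (_ * _); rewrite mxE.
Qed.

Lemma Ec_zz k' : Ec P (zz p sa2 ss2 beta gbar Rk pil gAP gS nP wP k k') = signal_mean k'.
Proof.
rewrite zzE (Ec_cdot GG _ _ (gaussian_vector_col G_eS G_eA)
   (gaussian_vector_col (G_hS k') (G_hA k'))).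
rewrite covmx_col mxtrace_block cdot_col (cdotE 0) big1 ?addr0; last first.
  by move=> j _; rewrite !mxE mulr0.
rewrite cov_hS_eS cov_hA_eA /signal_mean; congr (_ + _); case: ifP => _.
  rewrite mxtraceZ mxtrace_diag; congr (_ + _).
  by apply: eq_bigr => m _; rewrite mxE.
by rewrite !mxtrace0 addr0.
Qed.

Lemma Er_sqmod_zz k' :
  (Er P (fun w => sqmod (zz p sa2 ss2 beta gbar Rk pil gAP gS nP wP k k' w)))%:C =
  signal_mean k' * conjc (signal_mean k') + cqf (gbar k) (Rk k') (gbar k)
  + (ptp Tp p)%:C * cqf (gbar k') (Rk k *m Phik *m Rk k) (gbar k')
  + ((ptp Tp p)%:C * \tr (Rk k' *m Rk k *m Phik *m Rk k)
     + \sum_(m < M) (gamma m * beta m k')%:C).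
Proof.
have -> : (fun w => sqmod (zz p sa2 ss2 beta gbar Rk pil gAP gS nP wP k k' w)) =
    (fun w => sqmod (cdot (alv + Ev w) (bev k' + Hv k' w))).
  by rewrite zzE.
rewrite (Er_sqmod_cdot GG _ _ (gaussian_vector_col G_eS G_eA)
   (gaussian_vector_col (G_hS k') (G_hA k'))).
rewrite -zzE Ec_zz !covmx_col !cqf_col0 cov_hS eqxx cov_eS.
congr (_ + _ + _ + _).
  by rewrite /cqf -scalemxAr -scalemxAl mxE.
(* The stacked channel covariance is block diagonal, so the trace of the product uses only the
   diagonal blocks of the estimate covariance; the satellite-AP blocks of the latter never have to
   be computed. *)
rewrite cov_hS_hA -(ctr_covmx GG (G_hS k') (G_hA k')) cov_hS_hA ctr0.
rewrite mulmx_block mxtrace_block !mulmx0 addr0 add0r; congr (_ + _).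
  by rewrite -scalemxAl mxtraceZ mxtrace_mulC !mulmxA.
rewrite cov_hA eqxx cov_eA diag_mxM mxtrace_diag; apply: eq_bigr => m _.
by rewrite !mxE realM.
Qed.

(** A matched filter whose second factor, the data noise, has zero mean and is uncorrelated with the
    estimate: only the two terms containing the noise covariance remain. *)
Lemma Er_sqmod_noiseS :
  (Er P (fun w => sqmod (cdot (ghatS p ss2 gbar Rk pil gS wP k w) (wS w))))%:C =
  ss2%:C * cdot (gbar k) (gbar k) + (ptp Tp p * ss2)%:C * \tr (Rk k *m Phik *m Rk k).
Proof.
have -> : (fun w => sqmod (cdot (ghatS p ss2 gbar Rk pil gS wP k w) (wS w))) =
    (fun w => sqmod (cdot (gbar k + eS w) (0 + wS w))).
  by apply/funext => w; rewrite ghatSE add0r.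
have cov0 : covmx P wS eS = 0.
  exact: (covmx_estimate0 GG _ G_hS (G_wP _) _ _ G_wS cov_wS_hS (cov_wS_wP _)).
rewrite (Er_sqmod_cdot GG _ _ G_eS G_wS) (Ec_cdot GG _ _ G_eS G_wS) cov0 mxtrace0.
rewrite cov_eS cov_wS.
rewrite (_ : cdot _ 0 = 0) ?addr0; last by rewrite /cdot mulmx0 mxE.
rewrite mul0r add0r cqf0r addr0; congr (_ + _).
  by rewrite /cqf mul_mx_scalar -scalemxAl mxE.
by rewrite mul_mx_scalar scalerA mxtraceZ realM (mulrC ss2).
Qed.

(** Stacking lets [covmx_estimate0], a statement on vectors, decorrelate the noise of AP [m] from
    its estimate through a diagonal entry. *)
Definition wAv w : 'cV[C]_M := \col_m wA m w.

Let wAv_coord m : (fun w => wAv w m 0) = coord (i := inr (inr (inr m))) ord0.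
Proof. by rewrite -wA_coord; apply/funext => w; rewrite mxE. Qed.

Let G_wAv : gaussian_vector G wAv. Proof. by move=> j; rewrite wAv_coord; exact: coord_in. Qed.

Lemma Er_sqmod_noiseA m :
  (Er P (fun w => sqmod ((ghatAP p sa2 beta pil gAP nP m k w)^* * wA m w)))%:C =
  (sa2 * gamma m)%:C.
Proof.
have cov0 : covmx P wAv eA = 0.
  apply: (covmx_estimate0 GG _ G_hA (G_vA _) _ _ G_wAv) => [k'|];
    apply/matrixP => a b.
    by rewrite (covmx_coord wAv_coord (hA_coord k')) Ec_coord0 ?mxE.
  by rewrite (covmx_coord wAv_coord (vA_coord (pil k))) Ec_coord0 ?mxE.
(* A single AP is a matched filter with one branch, indexed by ['I_1]. *)
pose E (_ : 'I_1) w := eA w m 0; pose H (_ : 'I_1) := wA m.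
have -> : (fun w => sqmod ((ghatAP p sa2 beta pil gAP nP m k w)^* * wA m w)) =
    (fun w => sqmod (\sum_a (0 + E a w)^*%C * (0 + H a w))).
  apply/funext => w; rewrite big_ord1 !add0r; congr sqmod.
  by rewrite ghatAPE.
have mean0 : Ec P (fun w => (eA w m 0)^*%C * wA m w) = 0.
  have := congr1 (fun A : 'M[C]_M => A m m) cov0; rewrite [LHS]mxE [RHS]mxE => <-.
  by congr (Ec P _); apply/funext => w; rewrite mulrC /wAv [in RHS]mxE.
rewrite (Er_sqmod_matched_filter GG (fun=> 0) (fun=> 0) (fun=> G_eA m) (fun=> G_wA m)).
rewrite (Ec_matched_filter GG (fun=> 0) (fun=> 0) (fun=> G_eA m) (fun=> G_wA m)).
rewrite !big_ord1 mean0 !(mul0r, mulr0, add0r, addr0).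
rewrite -realM mulrC; congr (_ * _).
  rewrite /H wA_coord Ec_coord /= !mxE mulr1n.
  by [].
have := congr1 (fun A : 'M[C]_M => A m m) cov_eA.
rewrite [LHS]mxE [RHS]mxE eqxx mulr1n mxE => <-.
by congr (Ec P _); apply/funext => w; rewrite mulrC.
Qed.

Variables (Q : {set 'I_K}) (rho : 'I_K -> R).
Hypothesis rho0 : forall k', k' \notin Q -> rho k' = 0.

Let k_in : k \in Pk. Proof. by rewrite inE. Qed.

(** Users of one pilot share the denominator [D m], so [c_mk' / c_mk = beta_mk' / beta_mk]. *)
Lemma cross_gain m k' : k' \in Pk ->
  s * beta m k' * c m = cAP p sa2 beta pil m k' / c m * gamma m.
Proof.
rewrite inE => /eqP kk'; rewrite /cAP /gammaAP.
have -> : Pset pil k' = Pk by apply/setP => i; rewrite !inE kk'.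
have s0 : 0 < s by rewrite sqrtr_gt0.
have b0 := beta0 m k.
move: (D m) (D0 m) s s2 s0 => x x0 y y2 y0; rewrite -y2; field.
by rewrite !gt_eqF.
Qed.

Lemma signal_mean_in k' : k' \in Pk -> signal_mean k' =
  cdot (gbar k) (gbar k') + (ptp Tp p)%:C * \tr (Rk k' *m Phik *m Rk k)
  + \sum_(m < M) (cAP p sa2 beta pil m k' / c m * gamma m)%:C.
Proof.
move=> kP; rewrite /signal_mean kP addrA; congr (_ + _).
by apply: eq_bigr => m _; rewrite cross_gain.
Qed.

Lemma signal_mean_self : signal_mean k =
  cdot (gbar k) (gbar k) + (ptp Tp p)%:C * \tr (Rk k *m Phik *m Rk k)
  + \sum_(m < M) (gamma m)%:C.
Proof.
rewrite signal_mean_in//; congr (_ + _); apply: eq_bigr => m _.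
rewrite divff ?mul1r// gt_eqF// divr_gt0//.
by rewrite mulr_gt0// sqrtr_gt0.
Qed.

Let tr_ctr n (A : 'M[C]_n) : conjc (\tr A) = \tr (ctr A).
Proof.
rewrite /mxtrace conj_sum.
by apply: eq_bigr => i _; rewrite !mxE.
Qed.

(** Reconciles the squared modulus in [SINR] with the plain square in [SINR_num]; the trace is real
    because [R_k Phi_k R_k] is Hermitian. *)
Lemma signal_mean_real : conjc (signal_mean k) = signal_mean k.
Proof.
have hB := ctr_pilot_inverse Pk (ltW ptp0) ss0 Rpsd.
rewrite signal_mean_self !conj_add conj_mul conj_real tr_ctr.
rewrite 2!ctrM hB Rherm !mulmxA; congr (_ + _ + _).
  rewrite !cdotE conj_sum.
  by apply: eq_bigr => j _; rewrite conj_mul conjcK mulrC.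
rewrite conj_sum.
by apply: eq_bigr => m _; rewrite conj_real.
Qed.

(** The first two sums of [MI] range over all users, active or not, whereas [SINR] sums over [Q];
    zero power outside [Q] bridges the two. *)
Let sum_active (f : 'I_K -> C) :
  \sum_(k' in Q) (rho k')%:C * f k' = (rho k)%:C * f k
    + \sum_(k' in Pk :\ k) (rho k')%:C * f k' + \sum_(k' in ~: Pk) (rho k')%:C * f k'.
Proof.
transitivity (\sum_k' (rho k')%:C * f k').
  rewrite big_mkcond; apply: eq_bigr => k' _; case: ifPn => // /rho0 ->.
  by rewrite mul0r.
rewrite (bigID (mem Pk))/= (bigD1 k)//=; congr (_ + _ + _).
  by apply: eq_bigl => k'; rewrite !inE andbC.
by apply: eq_bigl => k'; rewrite !inE.
Qed.

Lemma total_power :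
  \sum_(k' in Q) (rho k')%:C *
     (Er P (fun w => sqmod (zz p sa2 ss2 beta gbar Rk pil gAP gS nP wP k k' w)))%:C =
  (rho k)%:C * (signal_mean k * conjc (signal_mean k)) +
  MI p sa2 ss2 beta gbar Rk pil Q rho k.
Proof.
transitivity (\sum_(k' in Q) (rho k')%:C * (signal_mean k' * conjc (signal_mean k'))
  + (ptp Tp p)%:C * \sum_(k' in Q) (rho k')%:C *
      cqf (gbar k') (Rk k *m Phik *m Rk k) (gbar k')
  + \sum_(k' in Q) (rho k')%:C * cqf (gbar k) (Rk k') (gbar k)
  + (ptp Tp p)%:C * \sum_(k' in Q) (rho k')%:C * \tr (Rk k' *m Rk k *m Phik *m Rk k)
  + \sum_(k' in Q) \sum_(m < M) (rho k' * gamma m * beta m k')%:C).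
  rewrite !mulr_sumr -!big_split/=; apply: eq_bigr => k' _.
  rewrite Er_sqmod_zz.
  have -> : \sum_(m < M) (rho k' * gamma m * beta m k')%:C =
      (rho k')%:C * \sum_(m < M) (gamma m * beta m k')%:C.
    by rewrite mulr_sumr; apply: eq_bigr => m _; rewrite realM mulrA.
  by move: (\sum_(m < M) _) => T; ring.
(* Only the coherent sum is split by pilot; the covariance sums keep the range [Q] on both sides. *)
rewrite sum_active /MI -!addrA; congr (_ + _); congr (_ + _).
  apply: eq_bigr => k'; rewrite !inE => /andP[_ kP].
  rewrite -signal_mean_in ?inE// normCK.
  by [].
congr (_ + _); apply: eq_bigr => k'; rewrite inE => /negbTE kP.
by rewrite /signal_mean kP addr0 normCK.
Qed.

Lemma SINR_closed_form :
  (SINR p sa2 ss2 beta gbar Rk pil gAP gS nP wP P wS wA Q rho k)%:C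
     = SINR_closed p sa2 ss2 beta gbar Rk pil Q rho k.
Proof.
(* The embedding of the reals is a field morphism, so numerators and denominators are compared
   separately, without discussing whether the denominator vanishes. *)
rewrite /SINR /SINR_closed fmorph_div.
have SE : (rho k * sqmod (Ec P (zz p sa2 ss2 beta gbar Rk pil gAP gS nP wP k k)))%:C =
    (rho k)%:C * (signal_mean k * conjc (signal_mean k)).
  by rewrite -realM sqmodE Ec_zz.
congr (_ / _).
  by rewrite /= SE signal_mean_real signal_mean_self -expr2.
rewrite !rmorphD rmorphN !rmorph_sum/= SE Er_sqmod_noiseS.
under eq_bigr do rewrite -realM.
under [X in _ + X = _]eq_bigr do rewrite Er_sqmod_noiseA.
rewrite total_power [X in X - _]addrC addrK /NO.
have -> : \sum_(m < M) (sa2 * gamma m)%:C = (sa2 * \sum_(m < M) gamma m)%:C :> C.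
  by rewrite mulr_sumr rmorph_sum.
by rewrite !addrA.
Qed.

End UplinkModel.

Theorem theorem1
  (R : realType) (M K N Tp Tc : nat) (B p sa2 ss2 : R)
  (beta : 'I_M -> 'I_K -> R) (gbar : 'I_K -> 'cV[R[i]]_N)
  (Rk : 'I_K -> 'M[R[i]]_N) (pil : 'I_K -> 'I_Tp)
  (d : measure_display) (Om : measurableType d) (P : probability Om R)
  (gAP : 'I_M -> 'I_K -> Om -> R[i]) (gS : 'I_K -> Om -> 'cV[R[i]]_N)
  (nP : 'I_M -> 'I_Tp -> Om -> R[i]) (wP : 'I_Tp -> Om -> 'cV[R[i]]_N)
  (wS : Om -> 'cV[R[i]]_N) (wA : 'I_M -> Om -> R[i])
  (Q : {set 'I_K}) (rho : 'I_K -> R) (k : 'I_K) :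
  0 < p -> 0 < sa2 -> 0 < ss2 ->
  (forall m k', 0 < beta m k') ->
  (forall k', psd (Rk k')) ->
  (* channel and noise distributions *)
  (forall m k', isCN1 P (gAP m k') 0 (beta m k')%:C) ->
  (forall k', isCN P (gS k') (gbar k') (Rk k')) ->
  (forall m t, isCN1 P (nP m t) 0 sa2%:C) ->
  (forall t, isCN P (wP t) 0 (ss2%:C)%:M) ->
  isCN P wS 0 (ss2%:C)%:M ->
  (forall m, isCN1 P (wA m) 0 sa2%:C) ->
  (* mutual independence of all channels and noises *)
  mutually_independent P (rv_family gAP gS nP wP wS wA) ->
  (* active users and their powers *)
  k \in Q ->
  (forall k', 0 <= rho k') ->
  (forall k', k' \notin Q -> rho k' = 0) ->
  (SINR p sa2 ss2 beta gbar Rk pil gAP gS nP wP P wS wA Q rho k)%:C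
     = SINR_closed p sa2 ss2 beta gbar Rk pil Q rho k /\
  throughput B Tp Tc (SINR p sa2 ss2 beta gbar Rk pil gAP gS nP wP P wS wA Q rho k)
     = throughput B Tp Tc (complex.Re (SINR_closed p sa2 ss2 beta gbar Rk pil Q rho k)).
Proof.
move=> p0 sa0 ss0 beta0 Rpsd CN_gAP CN_gS CN_nP CN_wP CN_wS CN_wA indF _ _ rho0.
have h := SINR_closed_form pil p0 sa0 ss0 beta0 Rpsd CN_gAP CN_gS CN_nP CN_wP CN_wS CN_wA
  indF k rho0.
by split; [exact: h|rewrite -h].
Qed.
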